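(* Consider the database model with side information available only at the user and a single utility constraint ($L=1$). Then $$\Gamma(D)=\sup_{p(\mathbf{x}_r,\mathbf{x}_h,z)p(u|\mathbf{x}_r,\mathbf{x}_h)\in\mathcal{P}(D)} H(\mathbf{X}_h\mid U,Z),$$ $$R(D,E)=\inf_{p(\mathbf{x}_r,\mathbf{x}_h,z)p(u|\mathbf{x}_r,\mathbf{x}_h)\in\mathcal{P}(D,E)} \big[I(\mathbf{X}_h\mathbf{X}_r;U)-I(Z;U)\big],$$ $$\mathcal{R}_{D-E}=\{(D,E):D\ge0,\ 0\le E\le\Gamma(D)\},$$ $$\mathcal{R}=\{(R,D,E):D\ge0,\ 0\le E\le\Gamma(D),\ R\ge R(D,E)\}.$$ Here $\mathcal{P}(D,E)$ is the set of all joint distributions of the form $p(\mathbf{x}_r,\mathbf{x}_h,z)\,p(u|\mathbf{x}_r,\mathbf{x}_h)$, where $p(\mathbf{x}_r,\mathbf{x}_h,z)$ is the given source distribution and $U$ is an auxiliary random variable on a finite alphabet (so that $U-(\mathbf{X}_r,\mathbf{X}_h)-Z$ is a Markov chain), for which there is a reconstruction function $\phi$ with $\mathbb{E}[d(\mathbf{X}_r,\phi(U,Z))]\le D$ and $H(\mathbf{X}_h\mid U,Z)\ge E$. Also $\mathcal{P}(D)=\bigcup_{H(\mathbf{X}_h|\mathbf{X}_r Z)\le E\le H(\mathbf{X}_h|Z)}\mathcal{P}(D,E)$.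
   Context: Database model: there are $K$ attributes, with $X_k$ taking values in a finite alphabet $\mathcal{X}_k$, $\mathbf{X}=(X_1,\dots,X_K)$ with a known joint pmf. Let $\mathcal{K}_r,\mathcal{K}_h\subseteq\{1,\dots,K\}$ with union $\{1,\dots,K\}$, $\mathbf{X}_r=(X_k)_{k\in\mathcal{K}_r}$ (public), and $\mathbf{X}_h=(X_k)_{k\in\mathcal{K}_h}$ (private). The triples $(\mathbf{X}_{r,i},\mathbf{X}_{h,i},Z_i)$, $i=1,\dots,n$, are i.i.d. with a given pmf $p(\mathbf{x}_r,\mathbf{x}_h,z)$, where $Z^n$ is side information available only to the user (the decoder), not to the encoder. A code of length $n$ consists of an encoder $F_E$ mapping $(\mathbf{X}_r^n,\mathbf{X}_h^n)$ to $W\in\{1,\dots,M\}$ and a decoder $F_D$ mapping $(W,Z^n)$ to $\hat{\mathbf{X}}_r^n$. The utility constraint is $\mathbb{E}[\frac1n\sum_{i=1}^n d(\mathbf{X}_{r,i},\hat{\mathbf{X}}_{r,i})]\le D+\epsilon$ for a given per-letter distortion $d$. The privacy constraint is $\frac1n H(\mathbf{X}_h^n\mid W,Z^n)\ge E-\epsilon$. The rate constraint is $M\le 2^{n(R+\epsilon)}$. $\mathcal{R}$ is the set of $(R,D,E)$ such that for every $\epsilon>0$ there exists a code, for some (sufficiently large) $n$, satisfying all three constraints; $\mathcal{R}_{D-E}$ is its projection onto the $(D,E)$ coordinates. $\Gamma(D)$ denotes the boundary of $\mathcal{R}_{D-E}$, namely the maximal achievable equivocation at distortion $D$. $R(D,E)$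 denotes the minimal rate $R$ with $(R,D,E)\in\mathcal{R}$.
   Formalization: The two region descriptions are claimed only among tuples with E ≥ 0, since negative E is trivially achievable under the stated definition, and the distortion d is assumed nonnegative, without which D ≥ 0 can fail. *)

(* Defs.v *)
From HB Require Import structures.
From mathcomp Require Import all_boot.
From Stdlib Require Import Reals.

Set Implicit Arguments.
Unset Strict Implicit.
Unset Printing Implicit Defensive.

Local Open Scope R_scope.

Definition fsum (T : finType) (f : T -> R) : R := \big[Rplus/R0]_(t : T) f t.

Definition is_pmf (T : finType) (P : T -> R) : Prop :=
  (forall t, 0 <= P t) /\ fsum P = 1.

Definition prob (T : finType) (P : T -> R) (ev : T -> bool) : R :=
  fsum (fun t => if ev t then P t else 0).

Definition log2 (x : R) : R := ln x / ln 2.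

Definition condH (T : finType) (P : T -> R) (A B : eqType)
  (f : T -> A) (g : T -> B) : R :=
  - fsum (fun t => P t *
      log2 (prob P (fun s => (f s == f t) && (g s == g t)) /
            prob P (fun s => g s == g t))).

Definition entH (T : finType) (P : T -> R) (A : eqType) (f : T -> A) : R :=
  condH P f (fun _ => tt).

Definition minfo (T : finType) (P : T -> R) (A B : eqType)
  (f : T -> A) (g : T -> B) : R :=
  entH P f - condH P f g.

Definition is_glb (E : R -> Prop) (m : R) : Prop :=
  (forall x, E x -> m <= x) /\ (forall b, (forall x, E x -> b <= x) -> b <= m).

Definition row (K : nat) (A : 'I_K -> finType) : finType :=
  {dffun forall k : 'I_K, A k}.

Definition subrow (K : nat) (A : 'I_K -> finType) (S : {set 'I_K}) : finType :=
  {dffun forall k : {k : 'I_K | k \in S}, A (sval k)}.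

Definition proj (K : nat) (A : 'I_K -> finType) (S : {set 'I_K})
  (x : row A) : subrow A S :=
  [ffun k : {k : 'I_K | k \in S} => x (sval k)].

Section Model.
Variables (K : nat) (A : 'I_K -> finType) (Kr Kh : {set 'I_K}) (Z : finType).
Variable p : row A * Z -> R.
Variable d : subrow A Kr -> subrow A Kr -> R.

Local Notation Xr := (subrow A Kr).
Local Notation Xh := (subrow A Kh).

Definition is_kernel (U : finType) (W : Xr -> Xh -> U -> R) : Prop :=
  forall xr xh, is_pmf (W xr xh).

Definition joint (U : finType) (W : Xr -> Xh -> U -> R) (t : (row A * Z) * U) : R :=
  p t.1 * W (proj Kr t.1.1) (proj Kh t.1.1) t.2.

Definition equiv1 (U : finType) (W : Xr -> Xh -> U -> R) : R :=
  condH (joint W) (fun t => proj Kh t.1.1) (fun t => (t.2, t.1.2)).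

Definition dist1 (U : finType) (W : Xr -> Xh -> U -> R) (phi : U -> Z -> Xr) : R :=
  fsum (fun t => joint W t * d (proj Kr t.1.1) (phi t.2 t.1.2)).

Definition rate1 (U : finType) (W : Xr -> Xh -> U -> R) : R :=
  minfo (joint W) (fun t => (proj Kh t.1.1, proj Kr t.1.1)) (fun t => t.2)
  - minfo (joint W) (fun t => t.1.2) (fun t => t.2).

Definition inPDE (D E : R) (U : finType) (W : Xr -> Xh -> U -> R) : Prop :=
  is_kernel W /\ exists phi : U -> Z -> Xr, dist1 W phi <= D /\ E <= equiv1 W.

Definition H_h_rZ : R :=
  condH p (fun s => proj Kh s.1) (fun s => (proj Kr s.1, s.2)).
Definition H_h_Z : R :=
  condH p (fun s => proj Kh s.1) (fun s => s.2).

Definition inPD (D : R) (U : finType) (W : Xr -> Xh -> U -> R) : Prop :=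
  exists E, H_h_rZ <= E /\ E <= H_h_Z /\ inPDE D E W.

Definition GammaSet (D : R) : R -> Prop :=
  fun e => exists (U : finType) (W : Xr -> Xh -> U -> R), inPD D W /\ e = equiv1 W.

Definition RateSet (D E : R) : R -> Prop :=
  fun r => exists (U : finType) (W : Xr -> Xh -> U -> R), inPDE D E W /\ r = rate1 W.

Definition pn (n : nat) (s : n.-tuple (row A * Z)) : R :=
  \big[Rmult/R1]_(i < n) p (tnth s i).

Definition xrn (n : nat) (s : n.-tuple (row A * Z)) : n.-tuple Xr :=
  map_tuple (fun t => proj Kr t.1) s.
Definition xhn (n : nat) (s : n.-tuple (row A * Z)) : n.-tuple Xh :=
  map_tuple (fun t => proj Kh t.1) s.
Definition zn (n : nat) (s : n.-tuple (row A * Z)) : n.-tuple Z :=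
  map_tuple (fun t => t.2) s.

Definition distn (n M : nat) (enc : n.-tuple Xr -> n.-tuple Xh -> 'I_M)
  (dec : 'I_M -> n.-tuple Z -> n.-tuple Xr) : R :=
  fsum (fun s => pn s *
    (/ INR n * \big[Rplus/R0]_(i < n)
        d (tnth (xrn s) i) (tnth (dec (enc (xrn s) (xhn s)) (zn s)) i))).

Definition equivn (n M : nat) (enc : n.-tuple Xr -> n.-tuple Xh -> 'I_M) : R :=
  / INR n * condH (@pn n) (@xhn n) (fun s => (enc (xrn s) (xhn s), zn s)).

Definition achievable (Rt D E : R) : Prop :=
  forall eps, 0 < eps ->
  exists n : nat, (0 < n)%nat /\
  exists (M : nat) (enc : n.-tuple Xr -> n.-tuple Xh -> 'I_M)
         (dec : 'I_M -> n.-tuple Z -> n.-tuple Xr),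
    distn enc dec <= D + eps /\
    E - eps <= equivn enc /\
    INR M <= Rpower 2 (INR n * (Rt + eps)).

Definition inRDE (D E : R) : Prop := exists Rt, achievable Rt D E.

End Model.

(* Main.v *)
(** Converse: for a code of length n with message J, put U = (Q, J, Z^{-Q})
    with Q uniform on the positions.  Since J is a function of the encoder's
    sequence and the source is memoryless, U - X_Q - Z_Q is a Markov chain; the
    distortion is reproduced exactly, and subadditivity of conditional entropy
    gives H(X_h^n | J, Z^n) <= n H(X_h | U, Z) and
    log M >= H(X^n | Z^n) - H(X^n | J, Z^n) >= n I(X; U | Z).

    Achievability: a codebook of about 2^{n I(X;U)} words is chosen greedily,
    each new word covering at least the average share of the source sequences
    that are still uncovered, and its words are then thrown into about
    2^{n (I(X;U) - I(Z;U))} bins.  If L is the index of the selected word, then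
    H(X_h^n | L, Z^n) >= H(X^n, Z^n) - H(L) - H(Z^n | L) - H(X_r^n | X_h^n, Z^n, L),
    and the last two terms are bounded letter by letter by entropies of the
    channel that the code induces from X_Q to the Q-th codeword letter, which is
    close to the given test channel.

    Closedness: the alphabet of U is unbounded, but Caratheodory's argument
    reduces it to |X| + 3 letters, after which limits of test channels exist;
    this turns the slack epsilon of the operational definition into the exact
    constraints of the single-letter region. *)

Require Import Defs.
From HB Require Import structures.
From mathcomp Require Import all_boot all_order all_algebra.
From mathcomp Require Import all_classical all_reals all_analysis.
From mathcomp Require Import ring lra.
Import Order.TTheory GRing.Theory Num.Theory numFieldNormedType.Exports.

Set Implicit Arguments.
Unset Strict Implicit.
Unset Printing Implicit Defensive.

Local Open Scope classical_set_scope.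
Local Open Scope ring_scope.

(** * Entropy on a finite probability space (in nats) *)

(** The delicate quantity in the direct part is the equivocation, about which correct decoding says
    nothing. The bin is a function of the index L, so conditioning on L can only lower the
    equivocation, and for U - X - Z the identity H(X_h|U,Z) = H(X,Z) - I(X;U) - H(Z|U) -
    H(X_r|X_h,U,Z) matches the bound for L term by term. Two facts then suffice: the codebook has
    rate close to I(X;U), and the induced joint law is close to the given one, entropies being
    continuous in the law. A second identity, I(X;U) - I(Z;U) = H(X|Z) - H(X|U,Z), turns the rate
    constraint into a lower bound on a conditional entropy given (U,Z). Distortion and both
    conditional entropies are sums over the letters of U of homogeneous functionals of a channel
    column. This explains the size |X| + 3: |X| normalizations and three values. All four claims are
    then order theory on one equivalence: (R,D,E) is achievable iff a single test channel meets the
    three constraints exactly. *)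

Section Entropy.
Context {R : realType} {Om : finType}.
Variable P : Om -> R.

Definition Pr (E : pred Om) : R := \sum_(t | E t) P t.

(** An expectation over sample points instead of a sum over values: only the partition into fibres
    of [f] counts, so the codomain may be any [eqType], and variables with the same fibres are
    exchanged by [ent_eq]. *)
Definition ent (A : eqType) (f : Om -> A) : R :=
  - \sum_t P t * ln (Pr (fun s => f s == f t)).

Definition cent (A B : eqType) (f : Om -> A) (g : Om -> B) : R :=
  ent (fun t => (f t, g t)) - ent g.

Lemma ent_eq (A B : eqType) (f : Om -> A) (g : Om -> B) :
  (forall s t, (f s == f t) = (g s == g t)) -> ent f = ent g.
Proof.
move=> fg; congr (- _); apply: eq_bigr => t _; congr (_ * ln _).
by apply: eq_bigl => s; exact: fg.
Qed.

Lemma cent_eq (A B A' B' : eqType) (f : Om -> A) (g : Om -> B)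
    (f' : Om -> A') (g' : Om -> B') :
  (forall s t, (f s == f t) && (g s == g t) =
               (f' s == f' t) && (g' s == g' t)) ->
  (forall s t, (g s == g t) = (g' s == g' t)) ->
  cent f g = cent f' g'.
Proof.
move=> fg gg; congr (_ - _); last exact: ent_eq.
by apply: ent_eq => s t; rewrite !xpair_eqE.
Qed.

Hypothesis P0 : forall t, 0 <= P t.

Lemma Pr_ge0 E : 0 <= Pr E. Proof. exact: sumr_ge0. Qed.

Lemma Pr_ge (E : pred Om) t : E t -> P t <= Pr E.
Proof. by move=> Et; rewrite /Pr (bigD1 t)//= lerDl sumr_ge0. Qed.

Lemma Pr_gt0 (A : eqType) (f : Om -> A) t :
  0 < P t -> 0 < Pr (fun s => f s == f t).
Proof. by move=> /lt_le_trans; apply; exact: Pr_ge. Qed.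

Lemma le_Pr (E F : pred Om) : (forall t, E t -> F t) -> Pr E <= Pr F.
Proof.
move=> EF; rewrite /Pr big_mkcond [leRHS]big_mkcond/=.
apply: ler_sum => t _; have := EF t.
by case: (E t); case: (F t) => // /(_ isT).
Qed.

Lemma Pr_cond_le1 (E : pred Om) : \sum_(t | E t) P t / Pr E <= 1.
Proof.
rewrite -mulr_suml -/(Pr E); have [->|E0] := eqVneq (Pr E) 0.
  by rewrite mul0r.
by rewrite divff.
Qed.

Lemma ln_le_sub1 (x : R) : 0 < x -> ln x <= x - 1.
Proof. by move=> x0; rewrite -{1}(subrKC 1 x); apply: le_ln1Dx; lra. Qed.

Hypothesis P1 : \sum_t P t = 1.

(** Nonnegativity of I(f; g | h): ln r <= r - 1 for the ratio r of P(f,h) P(g,h) to P(f,g,h) P(h),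
    whose mean is at most 1. The monotonicity and subadditivity of conditional entropy below rest on
    it. *)
Lemma ent_submod (A B C : eqType) (f : Om -> A) (g : Om -> B) (h : Om -> C) :
  ent (fun t => (f t, (g t, h t))) + ent h <=
  ent (fun t => (f t, h t)) + ent (fun t => (g t, h t)).
Proof.
pose fg t := Pr (fun s => (f s, (g s, h s)) == (f t, (g t, h t))).
pose fh t := Pr (fun s => (f s, h s) == (f t, h t)).
pose gh t := Pr (fun s => (g s, h s) == (g t, h t)).
pose hh t := Pr (fun s => h s == h t).
rewrite /ent -!opprD -!big_split/= lerN2.
pose r t := fh t * gh t / (fg t * hh t).
rewrite -subr_le0 -sumrB.
apply: (@le_trans _ _ (\sum_t P t * (r t - 1))).
  apply: ler_sum => t _; have := P0 t; rewrite le_eqVlt => /orP[/eqP <-|Pt].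
    by rewrite !mul0r addr0 subrr.
  rewrite -!mulrDr -mulrBr ler_wpM2l// ?(ltW Pt)//.
  have a1 : 0 < fg t by exact: (@Pr_gt0 _ (fun s => (f s, (g s, h s)))).
  have a2 : 0 < fh t by exact: (@Pr_gt0 _ (fun s => (f s, h s))).
  have a3 : 0 < gh t by exact: (@Pr_gt0 _ (fun s => (g s, h s))).
  have a4 : 0 < hh t by exact: Pr_gt0.
  have E : ln (r t) = ln (fh t) + ln (gh t) - (ln (fg t) + ln (hh t)).
    rewrite /r ln_div ?posrE ?mulr_gt0//.
    by congr (_ - _); apply: lnM; rewrite posrE.
  have H : ln (r t) <= r t - 1 by rewrite ln_le_sub1// divr_gt0 ?mulr_gt0.
  by rewrite E in H; exact: H.
under eq_bigr do rewrite mulrBr mulr1.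
rewrite sumrB P1 subr_le0.
(* [s] and [q] expand the fibre masses [fh t] and [gh t]. Summing over [t] first leaves a total
   conditional probability, at most 1; the sum over [q] is then another one. *)
pose k s t q : R := if [&& f s == f t, h s == h t, g q == g t & h q == h t]
  then P s * P q else 0.
have -> : \sum_t P t * r t = \sum_t \sum_s \sum_q P t / (fg t * hh t) * k s t q.
  apply: eq_bigr => t _; under [RHS]eq_bigr do rewrite -mulr_sumr.
  rewrite -mulr_sumr /r [fh t * _ / _]mulrC mulrA; congr (_ * _).
  rewrite /fh /gh /Pr mulr_suml big_mkcond/=; apply: eq_bigr => s _.
  rewrite mulr_sumr big_mkcond/=.
  rewrite xpair_eqE; case: ifP => fs; last first.
    rewrite big1// => q _; rewrite /k.
    by move: fs; case: eqP => //= _; case: eqP.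
  apply: eq_bigr => q _; rewrite /k.
  by move: fs => /andP[-> ->]/=; rewrite xpair_eqE.
rewrite exchange_big/=.
under eq_bigr do rewrite exchange_big/=.
apply: (@le_trans _ _ (\sum_s \sum_q (if h q == h s then P q / hh s else 0) * P s)).
  apply: ler_sum => s _; apply: ler_sum => q _; case: ifPn => hq; last first.
    rewrite big1 ?mul0r// => t _; rewrite /k.
    case: ifP; last by rewrite mulr0.
    by move=> /and4P[_ /eqP h1 _ /eqP h2]; rewrite h1 h2 eqxx in hq.
  pose E t := (f t, (g t, h t)) == (f s, (g q, h s)).
  apply: (@le_trans _ _ ((\sum_(t | E t) P t / Pr E) * (P q / hh s * P s))).
    rewrite mulr_suml [leRHS]big_mkcond/=; apply: ler_sum => t _.
    rewrite /k; case: ifP; last first.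
      rewrite mulr0; case: ifP => // _ _.
      by rewrite !mulr_ge0 ?invr_ge0 ?Pr_ge0.
    move=> /and4P[/eqP h1 /eqP h2 /eqP h3 /eqP h4].
    rewrite ifT; last by rewrite /E !xpair_eqE h1 h2 h3 !eqxx.
    have -> : fg t = Pr E by rewrite /fg /E h1 h2 h3.
    have -> : hh t = hh s by rewrite /hh h2.
    by rewrite invfM le_eqVlt; apply/orP; left; apply/eqP; ring.
  apply: ler_piMl; last exact: Pr_cond_le1.
  by rewrite !mulr_ge0 ?invr_ge0 ?Pr_ge0.
rewrite -P1; apply: ler_sum => s _; rewrite -mulr_suml -big_mkcond/=.
apply: ler_piMl => //; exact: Pr_cond_le1.
Qed.

Lemma cent_mono (A B C : eqType) (f : Om -> A) (g : Om -> B) (h : Om -> C) :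
  cent f (fun t => (g t, h t)) <= cent f h.
Proof. by have := ent_submod f g h; rewrite /cent; lra. Qed.

Lemma cent_chain (A B C : eqType) (f : Om -> A) (g : Om -> B) (h : Om -> C) :
  cent (fun t => (f t, g t)) h = cent g h + cent f (fun t => (g t, h t)).
Proof.
rewrite /cent [RHS]addrC addrA subrK; congr (_ - _).
by apply: ent_eq => s t; rewrite !xpair_eqE andbA.
Qed.

Lemma ent_mono (A B : eqType) (f : Om -> A) (g : Om -> B) :
  ent g <= ent (fun t => (f t, g t)).
Proof.
rewrite /ent lerN2; apply: ler_sum => t _.
have := P0 t; rewrite le_eqVlt => /orP[/eqP <-|Pt]; first by rewrite !mul0r.
rewrite ler_wpM2l// ?(ltW Pt)// ler_ln ?posrE.
- by apply: le_Pr => s; rewrite xpair_eqE => /andP[].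
- exact: (@Pr_gt0 _ (fun s => (f s, g s))).
- exact: Pr_gt0.
Qed.

Lemma cent_ge0 (A B : eqType) (f : Om -> A) (g : Om -> B) : 0 <= cent f g.
Proof. by rewrite subr_ge0; exact: ent_mono. Qed.

Lemma cent_le_ent (A B : eqType) (f : Om -> A) (g : Om -> B) : cent f g <= ent f.
Proof.
have := ent_submod f g (fun=> tt).
rewrite (_ : ent (fun=> tt) = 0); last first.
  rewrite /ent /Pr; under eq_bigr do rewrite (eq_bigl xpredT) // P1 ln1 mulr0.
  by rewrite big1 ?oppr0.
rewrite (@ent_eq _ _ (fun t => (f t, (g t, tt))) (fun t => (f t, g t))); last first.
  by move=> s t; rewrite !xpair_eqE eqxx !andbT.
rewrite (@ent_eq _ _ (fun t => (f t, tt)) f); last first.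
  by move=> s t; rewrite !xpair_eqE eqxx !andbT.
rewrite (@ent_eq _ _ (fun t => (g t, tt)) g); last first.
  by move=> s t; rewrite !xpair_eqE eqxx !andbT.
by rewrite /cent; lra.
Qed.

Lemma cent_mono_fun (A B C : eqType) (f : Om -> A) (g : Om -> B) (h : Om -> C) :
  (forall s t, g s == g t -> h s == h t) -> cent f g <= cent f h.
Proof.
move=> gh; rewrite (_ : cent f g = cent f (fun t => (g t, h t))).
  exact: cent_mono.
by apply: cent_eq => s t; rewrite xpair_eqE; have := gh s t; case: (g s == g t) => //= ->.
Qed.

(** Comparison with the uniform law: with q the fibre mass, ent f - ln |A| is the mean of ln (1 /
    (|A| q)), and ln x <= x - 1 leaves the mean of 1 / (|A| q), which is at most 1. *)
Lemma ent_le_ln (A : finType) (f : Om -> A) : ent f <= ln #|A|%:R.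
Proof.
have [t0 Pt0] : exists t, 0 < P t.
  apply/existsP; apply: contraT; rewrite negb_exists => /forallP H.
  have : \sum_t P t = 0.
    by apply: big1 => t _; apply/eqP; rewrite eq_le P0 andbT leNgt.
  by rewrite P1 => /eqP; rewrite oner_eq0.
have A0 : 0 < #|A|%:R :> R by rewrite ltr0n; apply/card_gt0P; exists (f t0).
have -> : ln #|A|%:R = \sum_t P t * ln #|A|%:R :> R by rewrite -mulr_suml P1 mul1r.
rewrite /ent -subr_ge0 opprK -big_split/=.
apply: (@le_trans _ _ (\sum_t P t * (1 - (#|A|%:R * Pr (fun s => f s == f t))^-1))).
  under eq_bigr do rewrite mulrBr mulr1.
  rewrite sumrB P1 subr_ge0.
  rewrite (partition_big f xpredT)//=.
  apply: (@le_trans _ _ (\sum_(a : A) #|A|%:R^-1)); last first.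
    by rewrite sumr_const -[_ *+ _]mulr_natl divff// gt_eqF.
  apply: ler_sum => a _.
  apply: (@le_trans _ _ (#|A|%:R^-1 * \sum_(t | f t == a) (P t / Pr (fun s => f s == a)))).
    rewrite mulr_sumr; apply: ler_sum => t /eqP ->.
    by rewrite invfM mulrCA.
  by rewrite ler_piMr ?invr_ge0 ?(ltW A0)//; exact: Pr_cond_le1.
apply: ler_sum => t _; rewrite -mulrDr.
have := P0 t; rewrite le_eqVlt => /orP[/eqP <-|Pt]; first by rewrite !mul0r.
have q0 := @Pr_gt0 _ f _ Pt.
rewrite ler_wpM2l// ?(ltW Pt)// addrC -lnM ?posrE//.
have := @ln_le_sub1 (#|A|%:R * Pr (fun s => f s == f t))^-1.
rewrite lnV ?posrE ?mulr_gt0// invr_gt0 mulr_gt0// => /(_ isT); lra.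
Qed.

Lemma cent_fam (I : finType) (A B : eqType) (f : I -> Om -> A) (g : Om -> B) :
  cent (fun t => [ffun i => f i t]) g <= \sum_i cent (f i) g.
Proof.
(* Lists let the chain rule peel off one index at a time; over the full enumeration they have the
   same fibres as the finite function. *)
pose F (r : seq I) t := [seq f i t | i <- r].
have H r : cent (F r) g <= \sum_(i <- r) cent (f i) g.
  elim: r => [|i r IH].
    rewrite big_nil /cent (@ent_eq _ _ _ g) ?subrr//.
  rewrite big_cons.
  have -> : cent (F (i :: r)) g = cent (fun t => (f i t, F r t)) g.
    by apply: cent_eq => // s t; rewrite /= eqseq_cons xpair_eqE.
  by rewrite cent_chain addrC lerD// cent_mono.
have := H (enum I); rewrite big_enum/=; congr (_ <= _).
apply: cent_eq => // s t; congr (_ && _); apply/idP/idP => /eqP E; apply/eqP.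
  apply/ffunP => i; rewrite !ffunE.
  have /eq_in_map := E; apply; exact: mem_enum.
by apply: eq_map => i; move/ffunP: E => /(_ i); rewrite !ffunE.
Qed.

End Entropy.

Arguments ent_eq {R Om P A B} f g _.
Arguments cent_eq {R Om P A B A' B'} f g f' g' _ _.

(** Change of sample space. That [P1] is the image of [P2] is stated through expectations, so that
    it applies both to the logarithms and to the indicators of fibres. *)
Lemma ent_push (R : realType) (O1 O2 : finType) (P1 : O1 -> R) (P2 : O2 -> R)
    (pi : O2 -> O1) (A : eqType) (f : O1 -> A) :
  (forall F : O1 -> R, \sum_t P1 t * F t = \sum_s P2 s * F (pi s)) ->
  ent P1 f = ent P2 (f \o pi).
Proof.
move=> H; rewrite /ent H; congr (- _); apply: eq_bigr => s _; congr (_ * ln _).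
rewrite /Pr big_mkcond [RHS]big_mkcond/=.
rewrite (eq_bigr (fun t => P1 t * (f t == f (pi s))%:R)); last first.
  by move=> t _; rewrite mulr_natr mulrb.
by rewrite H; apply: eq_bigr => t _; rewrite mulr_natr mulrb.
Qed.

Lemma cent_push (R : realType) (O1 O2 : finType) (P1 : O1 -> R) (P2 : O2 -> R)
    (pi : O2 -> O1) (A B : eqType) (f : O1 -> A) (g : O1 -> B) :
  (forall F : O1 -> R, \sum_t P1 t * F t = \sum_s P2 s * F (pi s)) ->
  cent P1 f g = cent P2 (f \o pi) (g \o pi).
Proof. by move=> H; rewrite /cent !(ent_push _ H). Qed.

(** * Time sharing: adjoining a uniform index to the sample space *)

Section TimeSharing.
Context {R : realType} {Om I : finType} (P : Om -> R).
Hypotheses (P0 : forall t, 0 <= P t) (P1 : \sum_t P t = 1) (I0 : (0 < #|I|)%N).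

Definition mixP (w : I * Om) : R := #|I|%:R^-1 * P w.2.

Lemma mixP_ge0 w : 0 <= mixP w.
Proof. by rewrite mulr_ge0// invr_ge0. Qed.

Lemma sum_mixP (F : I * Om -> R) :
  \sum_w mixP w * F w = #|I|%:R^-1 * \sum_i \sum_s P s * F (i, s).
Proof.
rewrite mulr_sumr.
under [RHS]eq_bigr do rewrite mulr_sumr.
rewrite pair_big/=; apply: eq_bigr => -[i s] _.
by rewrite /mixP/= mulrA.
Qed.

Lemma mixP1 : \sum_w mixP w = 1.
Proof.
under eq_bigr do rewrite -[mixP _]mulr1.
rewrite sum_mixP; under eq_bigr do under eq_bigr do rewrite mulr1.
under eq_bigr do rewrite P1.
by rewrite sumr_const mulVf// pnatr_eq0 -lt0n.
Qed.

(** The index contributes its own entropy ln |I|, which cancels in [cent_mix]. *)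
Lemma ent_mix (A : eqType) (f : I -> Om -> A) :
  ent mixP (fun w => (f w.1 w.2, w.1)) =
  #|I|%:R^-1 * (\sum_i ent P (f i)) + ln #|I|%:R.
Proof.
have c0 : 0 < #|I|%:R :> R by rewrite ltr0n.
rewrite {1}/ent sum_mixP -mulrN -sumrN.
have -> : ln #|I|%:R = #|I|%:R^-1 * \sum_(i : I) ln #|I|%:R :> R.
  by rewrite sumr_const -(mulr_natl (ln _)) mulKf// gt_eqF.
rewrite -mulrDr -big_split/=; congr (_ * _); apply: eq_bigr => i _.
have -> : ln #|I|%:R = \sum_s P s * ln #|I|%:R :> R by rewrite -mulr_suml P1 mul1r.
rewrite /ent -!sumrN -big_split/=; apply: eq_bigr => s _.
rewrite -!mulrN -mulrDr.
have := P0 s; rewrite le_eqVlt => /orP[/eqP <-|Ps]; first by rewrite !mul0r.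
congr (_ * _).
have -> : Pr mixP (fun w => (f w.1 w.2, w.1) == (f i s, i)) =
   #|I|%:R^-1 * Pr P (fun s' => f i s' == f i s).
  rewrite /Pr big_mkcond/= (eq_bigr (fun w => mixP w *
     ((f w.1 w.2, w.1) == (f i s, i))%:R)); last first.
    by move=> w _; rewrite mulr_natr mulrb.
  rewrite sum_mixP; congr (_ * _).
  rewrite (bigD1 i)//= [X in _ + X]big1 ?addr0; last first.
    move=> j ji; rewrite big1// => s' _.
    by rewrite xpair_eqE (negbTE ji) andbF mulr0.
  rewrite [RHS]big_mkcond/=; apply: eq_bigr => s' _.
  by rewrite xpair_eqE eqxx andbT mulr_natr mulrb.
rewrite lnM ?posrE ?invr_gt0 ?Pr_gt0// lnV ?posrE//; ring.
Qed.

Lemma cent_mix (A B : eqType) (f : I -> Om -> A) (g : I -> Om -> B) :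
  cent mixP (fun w => f w.1 w.2) (fun w => (g w.1 w.2, w.1)) =
  #|I|%:R^-1 * \sum_i cent P (f i) (g i).
Proof.
rewrite /cent ent_mix.
rewrite (ent_eq _ (fun w => ((f w.1 w.2, g w.1 w.2), w.1))); last first.
  by move=> s t; rewrite !xpair_eqE andbA.
rewrite (ent_mix (fun i s => (f i s, g i s))) sumrB; ring.
Qed.

End TimeSharing.

(** * Continuity of entropy in the law *)

Section EntropyLimit.
Context {R : realType}.

Lemma cvg_finsum (I : Type) (F : set_system I) (FF : Filter F) (J : finType)
    (Q : pred J) (h : I -> J -> R) (l : J -> R) :
  (forall j, h k j @[k --> F] --> l j) ->
  (\sum_(j | Q j) h k j) @[k --> F] --> \sum_(j | Q j) l j.
Proof.
move=> hl; elim: (index_enum J) => [|j r IH].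
  rewrite big_nil (_ : (fun k => _) = fun=> 0); first exact: cvg_cst.
  by apply/funext => k; rewrite big_nil.
rewrite big_cons (_ : (fun k => _) = fun k =>
  if Q j then h k j + \sum_(i <- r | Q i) h k i else \sum_(i <- r | Q i) h k i).
  by case: (Q j) => //; apply: cvgD.
by apply/funext => k; rewrite big_cons.
Qed.

Definition xlnx (x : R) : R := x * ln x.

Lemma cvg_xlnx (I : Type) (F : set_system I) (FF : Filter F) (h : I -> R) (l : R) :
  (forall k, 0 <= h k) -> 0 <= l ->
  h k @[k --> F] --> l -> xlnx (h k) @[k --> F] --> xlnx l.
Proof.
move=> h0 l0 hl; move: l0; rewrite le_eqVlt => /orP[/eqP l0|l0]; last first.
  apply: cvgM => //.
  by apply: (continuous_cvg _ _ hl); exact: continuous_ln.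
rewrite -l0 /xlnx mul0r.
(* At 0, with s the square root of h, ln (1/s) <= 1/s - 1 gives |h ln h| = 2 s^2 ln (1/s) <= 2 s;
   hence the threshold [e / 2] for s. *)
have hs : Num.sqrt (h k) @[k --> F] --> (0 : R).
  rewrite -[X in _ --> X](@sqrtr0 R) [in X in _ --> X]l0.
  by apply: (continuous_cvg _ _ hl); exact: sqrt_continuous.
have h1 : \forall k \near F, h k < 1.
  by move/cvgr_lt: hl; apply; rewrite -l0 ltr01.
apply/cvgr0Pnorm_lt => e e0.
have h2 : \forall k \near F, Num.sqrt (h k) < e / 2.
  by move/cvgr_lt: hs; apply; rewrite divr_gt0.
near=> k.
have hk1 : h k < 1 by near: k.
have hk2 : Num.sqrt (h k) < e / 2 by near: k.
have := h0 k; rewrite le_eqVlt => /orP[/eqP <-|hk0]; first by rewrite mul0r normr0.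
set s := Num.sqrt (h k) in hk2 *.
have s0 : 0 < s by rewrite sqrtr_gt0.
have hE : h k = s ^+ 2 by rewrite sqr_sqrtr// ltW.
have ls : - ln s <= s^-1 - 1.
  by rewrite -lnV ?posrE// ln_le_sub1// invr_gt0.
have ln0 : ln (h k) <= 0 by rewrite ln_le0// ltW.
rewrite ler0_norm ?mulr_ge0_le0//.
rewrite hE lnXn// mulr2n -mulrN opprD.
have : s ^+ 2 * (- ln s + - ln s) <= s ^+ 2 * (s^-1 + s^-1).
  by rewrite ler_wpM2l ?sqr_ge0//; lra.
have -> : s ^+ 2 * (s^-1 + s^-1) = 2 * s by field; rewrite gt_eqF.
lra.
Unshelve. all: by end_near. Qed.

Lemma ent_sum (Om A : finType) (P : Om -> R) (f : Om -> A) :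
  ent P f = - \sum_a xlnx (Pr P (fun s => f s == a)).
Proof.
rewrite /ent (partition_big f xpredT)//=; congr (- _); apply: eq_bigr => a _.
rewrite /xlnx {2}/Pr mulr_suml; apply: eq_bigr => t /eqP ->; by [].
Qed.

Lemma cvg_ent (I : Type) (F : set_system I) (FF : Filter F) (Om A : finType)
    (P : I -> Om -> R) (Q : Om -> R) (f : Om -> A) :
  (forall k t, 0 <= P k t) -> (forall t, 0 <= Q t) ->
  (forall t, P k t @[k --> F] --> Q t) ->
  ent (P k) f @[k --> F] --> ent Q f.
Proof.
move=> P0 Q0 PQ; rewrite ent_sum.
rewrite (_ : (fun k => ent (P k) f) =
   (fun k => - \sum_a xlnx (Pr (P k) (fun s => f s == a)))); last first.
  by apply/funext => k; rewrite ent_sum.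
apply: cvgN; apply: cvg_finsum => a.
apply: cvg_xlnx => [k||]; try exact: Pr_ge0.
exact: cvg_finsum.
Qed.

Lemma cvg_cent (I : Type) (F : set_system I) (FF : Filter F) (Om A B : finType)
    (P : I -> Om -> R) (Q : Om -> R) (f : Om -> A) (g : Om -> B) :
  (forall k t, 0 <= P k t) -> (forall t, 0 <= Q t) ->
  (forall t, P k t @[k --> F] --> Q t) ->
  cent (P k) f g @[k --> F] --> cent Q f g.
Proof. by move=> P0 Q0 PQ; apply: cvgB; exact: cvg_ent. Qed.

End EntropyLimit.

(** * Memoryless sources, single-letter quantities and the converse *)

Section Upd.
Context {I : finType} {T : Type}.

Definition upd (s : {ffun I -> T}) (i : I) (t : T) : {ffun I -> T} :=
  [ffun j => if j == i then t else s j].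

Lemma upd_same s i t : upd s i t i = t.
Proof. by rewrite ffunE eqxx. Qed.

Lemma upd_upd s i t t' : upd (upd s i t) i t' = upd s i t'.
Proof. by apply/ffunP => j; rewrite /upd !ffunE; case: eqP. Qed.

Lemma upd_id s i : upd s i (s i) = s.
Proof. by apply/ffunP => j; rewrite ffunE; case: eqP => [->|]. Qed.

End Upd.

Definition ffmap {I : finType} {T S : Type} (f : T -> S) (s : {ffun I -> T}) :
  {ffun I -> S} := [ffun i => f (s i)].

Lemma ffmap_upd (I : finType) (T S : Type) (f : T -> S) (s : {ffun I -> T}) i t :
  ffmap f (upd s i t) = upd (ffmap f s) i (f t).
Proof. by apply/ffunP => j; rewrite !ffunE; case: ifP. Qed.

Section Product.
Context {R : realType} {I T : finType} (p : T -> R).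

Definition prodP (s : {ffun I -> T}) : R := \prod_i p (s i).

Hypotheses (p0 : forall t, 0 <= p t) (p1 : \sum_t p t = 1).

Lemma prodP_ge0 s : 0 <= prodP s.
Proof. exact: prodr_ge0. Qed.

Lemma sum_prodP : \sum_s prodP s = 1.
Proof.
rewrite /prodP -(bigA_distr_bigA (fun _ : I => p)).
by rewrite big1.
Qed.

(* The swap of the sampled coordinate [s i] with a fresh sample [t] is a
   measure-preserving involution. *)
Lemma resample (i : I) (F : {ffun I -> T} -> R) :
  \sum_s prodP s * F s = \sum_t \sum_s p t * prodP s * F (upd s i t).
Proof.
rewrite pair_big/=.
pose phi (w : T * {ffun I -> T}) := (w.2 i, upd w.2 i w.1).
have phiK : involutive phi.
  by move=> [t s]; rewrite /phi/= upd_same upd_upd upd_id.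
rewrite [RHS](eq_bigr (fun w => p (phi w).1 * prodP (phi w).2 * F (phi w).2)); last first.
  move=> [t s] _ /=; congr (_ * _).
  rewrite /prodP (bigD1 i)//= [in RHS](bigD1 i)//= upd_same !mulrA.
  rewrite [p t * _]mulrC; congr (_ * _); apply: eq_bigr => j ji.
  by rewrite ffunE (negbTE ji).
rewrite -(reindex_inj (P := xpredT) (F := fun w => p w.1 * prodP w.2 * F w.2) (inv_inj phiK)).
rewrite -(pair_big xpredT xpredT (fun t s => p t * prodP s * F s))/=.
rewrite exchange_big/=; apply: eq_bigr => s _.
by rewrite -!mulr_suml p1 mul1r.
Qed.

Lemma sum_prodP_coord (i : I) (F : T -> R) :
  \sum_s prodP s * F (s i) = \sum_t p t * F t.
Proof.
rewrite (resample i (fun s => F (s i))); apply: eq_bigr => t _.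
under eq_bigr do rewrite upd_same mulrAC.
by rewrite -mulr_sumr sum_prodP mulr1.
Qed.

Lemma Pr_prod (A : eqType) (f : T -> A) (s : {ffun I -> T}) :
  Pr prodP (fun s' => ffmap f s' == ffmap f s) =
  \prod_i Pr p (fun t => f t == f (s i)).
Proof.
rewrite /Pr /prodP (bigA_distr_big_dep (fun i t => f t == f (s i)) (fun i t => p t)).
apply: eq_bigl => s'; apply/eqP/familyP => [E i|E].
  by move/ffunP: E => /(_ i); rewrite !ffunE unfold_in => ->.
by apply/ffunP => i; rewrite !ffunE; have := E i; rewrite unfold_in => /eqP.
Qed.

Lemma ent_prod (A : eqType) (f : T -> A) :
  ent prodP (ffmap f) = #|I|%:R * ent p f.
Proof.
have -> : #|I|%:R * ent p f = \sum_(i : I) ent p f.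
  by rewrite sumr_const mulr_natl.
rewrite /ent sumrN; congr (- _).
under [RHS]eq_bigr => i _ do
  rewrite -(sum_prodP_coord i (fun t => ln (Pr p (fun s => f s == f t)))).
rewrite exchange_big/=; apply: eq_bigr => s _.
rewrite -mulr_sumr.
have := prodP_ge0 s; rewrite le_eqVlt => /orP[/eqP <-|Ps]; first by rewrite !mul0r.
rewrite Pr_prod; congr (_ * _).
have {}Ps i : 0 < p (s i).
  rewrite lt_neqAle p0 andbT eq_sym; apply/negP => /eqP E.
  by move: Ps; rewrite /prodP (bigD1 i)//= E mul0r ltxx.
have H i : 0 < Pr p (fun t => f t == f (s i)) by exact: Pr_gt0.
elim: (index_enum I) => [|i r IH]; first by rewrite !big_nil ln1.
by rewrite !big_cons lnM ?posrE// ?IH// prodr_gt0.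
Qed.

End Product.

Section Source.
Context {R : realType} {T Xr Xh Zt : finType}.
Local Notation X := (Xr * Xh)%type.
Variables (p : T -> R) (a : T -> X) (z : T -> Zt) (d : Xr -> Xr -> R).

Definition channel (U : finType) (W : X -> U -> R) :=
  (forall x u, 0 <= W x u) /\ (forall x, \sum_u W x u = 1).

Definition sjoint (U : finType) (W : X -> U -> R) (w : T * U) : R :=
  p w.1 * W (a w.1) w.2.

Definition sequiv (U : finType) (W : X -> U -> R) : R :=
  cent (sjoint W) (fun w => (a w.1).2) (fun w => (w.2, z w.1)).

Definition sdist (U : finType) (W : X -> U -> R) (phi : U -> Zt -> Xr) : R :=
  \sum_w sjoint W w * d (a w.1).1 (phi w.2 (z w.1)).

Definition srate (U : finType) (W : X -> U -> R) : R :=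
  (ent (sjoint W) (fun w => a w.1) -
     cent (sjoint W) (fun w => a w.1) (fun w => w.2)) -
  (ent (sjoint W) (fun w => z w.1) -
     cent (sjoint W) (fun w => z w.1) (fun w => w.2)).

Hypotheses (p0 : forall t, 0 <= p t) (p1 : \sum_t p t = 1).

Section Kernel.
Context {U : finType} {W : X -> U -> R}.
Hypothesis Wk : channel W.

Lemma sjoint_ge0 w : 0 <= sjoint W w.
Proof. by rewrite mulr_ge0//; apply Wk. Qed.

Lemma sum_sjoint_fst (F : T -> R) : \sum_w sjoint W w * F w.1 = \sum_t p t * F t.
Proof.
rewrite -(pair_bigA _ (fun t u => sjoint W (t, u) * F t))/=.
apply: eq_bigr => t _; rewrite -mulr_suml; congr (_ * _).
by rewrite /sjoint/= -mulr_sumr (Wk.2 _) mulr1.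
Qed.

Lemma sum_sjoint : \sum_w sjoint W w = 1.
Proof.
rewrite -p1; have := sum_sjoint_fst (fun=> 1).
by under eq_bigr do rewrite mulr1; under [in RHS]eq_bigr do rewrite mulr1.
Qed.

Lemma ent_sjoint_fst (A : eqType) (f : T -> A) :
  ent (sjoint W) (fun w => f w.1) = ent p f.
Proof. by rewrite (ent_push (P2 := sjoint W) (pi := fst))// => F; rewrite sum_sjoint_fst. Qed.

(* The term [- \sum_w _] is the conditional entropy of [U] given the source,
   and [U] depends on the source only through [a]. *)
Lemma ent_sjoint_pair (A : eqType) (f : T -> A) :
  (forall s t, f s = f t -> a s = a t) ->
  ent (sjoint W) (fun w => (f w.1, w.2)) =
  ent p f - \sum_w sjoint W w * ln (W (a w.1) w.2).
Proof.
move=> fa; rewrite -(ent_sjoint_fst f) /ent -opprD; congr (- _).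
rewrite -big_split/=; apply: eq_bigr => -[t u] _ /=; rewrite -mulrDr.
have := sjoint_ge0 (t, u); rewrite le_eqVlt => /orP[/eqP <-|J0].
  by rewrite !mul0r.
congr (_ * _).
have W0 : 0 < W (a t) u.
  rewrite lt_neqAle (Wk.1 _ _) andbT eq_sym; apply/negP => /eqP E.
  by move: J0; rewrite /sjoint/= E mulr0 ltxx.
rewrite -lnM ?posrE//; last exact: (Pr_gt0 sjoint_ge0 (fun w => f w.1) J0).
congr ln; rewrite /Pr [in RHS]big_mkcond/= [in LHS]big_mkcond/=.
rewrite -(pair_bigA _ (fun s v => if (f s, v) == (f t, u) then sjoint W (s, v) else 0))/=.
rewrite -(pair_bigA _ (fun s v => if f s == f t then sjoint W (s, v) else 0))/=.
rewrite mulr_suml; apply: eq_bigr => s _.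
have [E|ne] := eqVneq (f s) (f t); last first.
  rewrite [in RHS]big1 ?mul0r// big1// => v _.
  by rewrite xpair_eqE (negbTE ne).
rewrite (bigD1 u)//= E eqxx [X in _ + X]big1 ?addr0; last first.
  by move=> v vu; rewrite xpair_eqE (negbTE vu) andbF.
by rewrite /sjoint/= -mulr_sumr (Wk.2 _) mulr1 (fa _ _ E).
Qed.

(** By the Markov chain H(U|X) = H(U|X,Z), so the difference of the two informations is I(X;U|Z).
    The conditioning on (U,Z), shared with the equivocation, serves both the converse and the
    decomposition into columns. *)
Lemma srateE : srate W =
  cent p a z - cent (sjoint W) (fun w => a w.1) (fun w => (w.2, z w.1)).
Proof.
rewrite /srate /cent.
rewrite (ent_sjoint_fst a) (ent_sjoint_fst z) (ent_sjoint_pair (f := a))//.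
rewrite (ent_eq (fun w => (a w.1, (w.2, z w.1))) (fun w => ((a w.1, z w.1), w.2))); last first.
  by move=> s t; rewrite !xpair_eqE [in RHS]andbAC andbA.
rewrite (@ent_sjoint_pair _ (fun t => (a t, z t))); last first.
  by move=> s t [->].
rewrite (ent_eq (fun w => (w.2, z w.1)) (fun w => (z w.1, w.2))); last first.
  by move=> s t; rewrite !xpair_eqE andbC.
ring.
Qed.

(** The shape in which the equivocation of a code is bounded in [code_equiv_ge]; the Markov chain
    enters through H(U|X,Z) = H(U|X). *)
Lemma sequivE : sequiv W =
  ent p (fun t => (a t, z t)) -
  (ent (sjoint W) (fun w => a w.1) -
     cent (sjoint W) (fun w => a w.1) (fun w => w.2)) -
  cent (sjoint W) (fun w => z w.1) (fun w => w.2) -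
  cent (sjoint W) (fun w => (a w.1).1) (fun w => ((a w.1).2, (w.2, z w.1))).
Proof.
rewrite /sequiv /cent.
rewrite (ent_sjoint_fst a) (ent_sjoint_pair (f := a))//.
rewrite (ent_eq (fun w => ((a w.1).1, ((a w.1).2, (w.2, z w.1))))
   (fun w => ((a w.1, z w.1), w.2))); last first.
  move=> [s v] [t u]; rewrite !xpair_eqE/=; case: (a s) => ? ?; case: (a t) => ? ?.
  by rewrite xpair_eqE/= -!andbA; do ! bool_congr.
rewrite (@ent_sjoint_pair _ (fun t => (a t, z t))); last first.
  by move=> s t [->].
rewrite (ent_eq (fun w => (w.2, z w.1)) (fun w => (z w.1, w.2))); last first.
  by move=> s t; rewrite !xpair_eqE andbC.
ring.
Qed.

End Kernel.

Section Induced.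
Context {n : nat} {U : finType} (h : 'I_n -> X -> {ffun 'I_n -> T} -> U).
Hypothesis n0 : (0 < n)%N.
Hypothesis hupd : forall i x s t, h i x (upd s i t) = h i x s.

Local Notation Pn := (@prodP R 'I_n T p).

(* The channel from the [i]-th source letter to [h i], for [i] uniform. *)
Definition induced_channel (x : X) (u : U) : R :=
  \sum_w mixP Pn w * (h w.1 x w.2 == u)%:R.

Let In0 : (0 < #|'I_n|)%N. Proof. by rewrite card_ord. Qed.

Lemma induced_channelP : channel induced_channel.
Proof.
split=> [x u|x].
  by apply: sumr_ge0 => w _; rewrite mulr_ge0// mixP_ge0// => s; exact: prodP_ge0.
rewrite exchange_big/= -[RHS](mixP1 (sum_prodP (I := 'I_n) p1) In0).
apply: eq_bigr => w _; rewrite -mulr_sumr (bigD1 (h w.1 x w.2))//= eqxx big1 ?addr0 ?mulr1//.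
by move=> u /negbTE; rewrite eq_sym => ->.
Qed.

(** By [hupd], [h i x s] sees the [i]-th letter only through [x]. Resampling that letter makes it
    independent of the rest of [s], so the letter and [h] have exactly the law of source times
    channel. *)
Lemma sum_induced (F : T * U -> R) :
  \sum_w sjoint induced_channel w * F w =
  \sum_v mixP Pn v * F (v.2 v.1, h v.1 (a (v.2 v.1)) v.2).
Proof.
rewrite (sum_mixP _ (fun v : 'I_n * {ffun 'I_n -> T} => F (v.2 v.1, h v.1 (a (v.2 v.1)) v.2)))/=.
have -> : \sum_i \sum_s Pn s * F (s i, h i (a (s i)) s) =
  \sum_i \sum_t \sum_s p t * Pn s * F (t, h i (a t) s).
  apply: eq_bigr => i _.
  rewrite (resample p1 i (fun s => F (s i, h i (a (s i)) s))).
  by apply: eq_bigr => t _; apply: eq_bigr => s _; rewrite upd_same hupd.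
rewrite exchange_big/= mulr_sumr.
transitivity (\sum_t \sum_u sjoint induced_channel (t, u) * F (t, u)).
  by rewrite pair_bigA; apply: eq_bigr => -[].
apply: eq_bigr => t _.
transitivity (p t * \sum_v mixP Pn v * F (t, h v.1 (a t) v.2)).
  under eq_bigr do rewrite /sjoint/= -mulrA mulr_suml.
  rewrite -mulr_sumr exchange_big/=; congr (_ * _); apply: eq_bigr => v _.
  rewrite (bigD1 (h v.1 (a t) v.2))//= eqxx mulr1 big1 ?addr0//.
  by move=> u /negbTE; rewrite eq_sym => ->; rewrite mulr0 mul0r.
rewrite (sum_mixP _ (fun v : 'I_n * {ffun 'I_n -> T} => F (t, h v.1 (a t) v.2)))/= mulrCA; congr (_ * _).
rewrite mulr_sumr; apply: eq_bigr => i _; rewrite mulr_sumr.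
by apply: eq_bigr => s _; rewrite mulrA.
Qed.

Lemma cent_induced (A B : eqType) (f : T * U -> A) (g : T * U -> B) :
  cent (sjoint induced_channel) f g =
  cent (mixP Pn) (fun v => f (v.2 v.1, h v.1 (a (v.2 v.1)) v.2))
                 (fun v => g (v.2 v.1, h v.1 (a (v.2 v.1)) v.2)).
Proof. exact: (cent_push _ _ sum_induced). Qed.

End Induced.

(** * The converse: from a block code to a test channel *)

Section Converse.
Context {n : nat} {J : finType}.
Variables (enc : {ffun 'I_n -> X} -> J)
          (dec : J -> {ffun 'I_n -> Zt} -> {ffun 'I_n -> Xr}).
Hypothesis n0 : (0 < n)%N.
Variable z0 : Zt.

Local Notation Pn := (@prodP R 'I_n T p).

Definition code_dist : R :=
  \sum_s Pn s * (n%:R^-1 * \sum_i d (a (s i)).1 (dec (enc (ffmap a s)) (ffmap z s) i)).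

Definition code_equiv : R :=
  n%:R^-1 * cent Pn (ffmap (snd \o a)) (fun s => (enc (ffmap a s), ffmap z s)).

(** The variable (Q, J, Z^{-Q}): the dummy letter [z0] erases position [i] of the side information,
    and [x] stands for the source letter there, as [hupd] demands. *)
Let h (i : 'I_n) (x : X) (s : {ffun 'I_n -> T}) : 'I_n * (J * {ffun 'I_n -> Zt}) :=
  (i, (enc (upd (ffmap a s) i x), upd (ffmap z s) i z0)).

Let hupd i x s t : h i x (upd s i t) = h i x s.
Proof. by rewrite /h !ffmap_upd !upd_upd. Qed.

Let hE (i : 'I_n) (s : {ffun 'I_n -> T}) : h i (a (s i)) s = (i, (enc (ffmap a s), upd (ffmap z s) i z0)).
Proof. by rewrite /h -ffmap_upd upd_id. Qed.

Let In0 : (0 < #|'I_n|)%N. Proof. by rewrite card_ord. Qed.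

Let Pn0 s : 0 <= Pn s. Proof. exact: prodP_ge0. Qed.
Let Pn1 : \sum_s Pn s = 1. Proof. exact: sum_prodP. Qed.

(** Given Z_Q as well, the erased position is restored: the conditioning amounts to (Q, J, Z^n), and
    [cent_mix] averages over Q. *)
Let centE (A : eqType) (f : T -> A) :
  cent (sjoint (induced_channel h)) (fun w => f w.1) (fun w => (w.2, z w.1)) =
  n%:R^-1 * \sum_(i < n) cent Pn (fun s => f (s i)) (fun s => (enc (ffmap a s), ffmap z s)).
Proof.
rewrite (cent_induced hupd)/=.
have -> : n%:R = #|'I_n|%:R :> R by rewrite card_ord.
rewrite -(cent_mix Pn0 Pn1 In0 (fun i s => f (s i))
  (fun _ s => (enc (ffmap a s), ffmap z s)))/=.
have E v w : (upd (ffmap z (v.2 : {ffun 'I_n -> T})) v.1 z0 == upd (ffmap z w.2) v.1 z0)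
   && (z (v.2 v.1) == z (w.2 v.1)) = (ffmap z v.2 == ffmap z w.2).
  apply/andP/eqP => [[/eqP /ffunP A1 /eqP A2]|B].
    apply/ffunP => j; have := A1 j; rewrite !ffunE.
    by case: eqP => [->|].
  split; first by rewrite B.
  by move/ffunP: B => /(_ v.1); rewrite !ffunE => ->.
have K (v w : 'I_n * {ffun 'I_n -> T}) :
   ((h v.1 (a (v.2 v.1)) v.2, z (v.2 v.1)) == (h w.1 (a (w.2 w.1)) w.2, z (w.2 w.1))) =
   ((enc (ffmap a v.2), ffmap z v.2, v.1) == (enc (ffmap a w.2), ffmap z w.2, w.1)).
  rewrite !hE !xpair_eqE; case: (eqVneq v.1 w.1) => [E1|]; last by rewrite !andbF.
  by rewrite -E1/= andbT -andbA E.
by apply: cent_eq => v w; [congr (_ && _)|]; exact: K.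
Qed.

Theorem converse : exists (U : finType) (W : X -> U -> R) (phi : U -> Zt -> Xr),
  [/\ channel W, sdist W phi = code_dist, code_equiv <= sequiv W &
      srate W <= n%:R^-1 * ln #|J|%:R].
Proof.
exists ('I_n * (J * {ffun 'I_n -> Zt}))%type, (induced_channel h).
(* The single-letter decoder writes its own [zz] into the erased position, runs the block decoder
   and keeps letter Q. *)
exists (fun u zz => dec u.2.1 (upd u.2.2 u.1 zz) u.1).
have kerW := induced_channelP h n0.
split=> //.
- rewrite /sdist (sum_induced hupd) sum_mixP/= card_ord exchange_big/=.
  rewrite /code_dist mulr_sumr; apply: eq_bigr => s _.
  rewrite -mulr_sumr mulrCA; do 2 congr (_ * _); apply: eq_bigr => i _.
  by rewrite upd_upd -!ffmap_upd upd_id.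
- rewrite /code_equiv /sequiv (centE (fun t => (a t).2)).
  rewrite ler_wpM2l ?invr_ge0//; apply: cent_fam => //.
- rewrite srateE// (centE a) lerBlDr -mulrDr.
  have c0 : 0 < n%:R :> R by rewrite ltr0n.
  rewrite -(ler_pM2l c0) mulVKf ?gt_eqF//.
  have F := cent_fam Pn0 Pn1 (fun i s => a (s i)) (fun s => (enc (ffmap a s), ffmap z s)).
  have E : n%:R * cent p a z = cent Pn (ffmap a) (ffmap z).
    have -> : n%:R = #|'I_n|%:R :> R by rewrite card_ord.
    rewrite /cent mulrBr -!ent_prod//; congr (_ - _).
    apply: ent_eq => s t; rewrite xpair_eqE.
    apply/eqP/andP => [/ffunP B|[/eqP/ffunP B1 /eqP/ffunP B2]].
      by split; apply/eqP/ffunP => i; have := B i; rewrite !ffunE => -[].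
    by apply/ffunP => i; have := B1 i; have := B2 i; rewrite !ffunE => -> ->.
  have G : cent Pn (ffmap a) (ffmap z) <= ln #|J|%:R +
      cent Pn (ffmap a) (fun s => (enc (ffmap a s), ffmap z s)).
    have := cent_chain Pn (ffmap a) (fun s => enc (ffmap a s)) (ffmap z).
    rewrite (cent_eq (fun s => (ffmap a s, enc (ffmap a s))) (ffmap z) (ffmap a) (ffmap z)) //; last first.
      by move=> s t; rewrite xpair_eqE; case: (eqVneq (ffmap a s) (ffmap a t)) => //= ->; rewrite eqxx.
    move=> ->; rewrite lerD2r.
    by apply: le_trans (ent_le_ln Pn0 Pn1 (fun s => enc (ffmap a s))); exact: cent_le_ent.
  by rewrite E (le_trans G)// lerD2l; exact: F.
Qed.

End Converse.

End Source.

(** * Closedness of the single-letter region *)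

Lemma exists_dependency (F : fieldType) (n : nat) (J : finType) (v : 'I_n -> J -> F) :
  (#|J| < n)%N ->
  exists2 c : 'I_n -> F, (exists i, c i != 0) & forall j, \sum_i c i * v i j = 0.
Proof.
move=> Jn; pose M : 'M[F]_(n, #|J|) := \matrix_(i, j) v i (enum_val j).
have : kermx M != 0.
  rewrite kermx_eq0 /row_free; apply/negP => /eqP rM.
  by have := rank_leq_col M; rewrite rM leqNgt Jn.
move=> /rowV0Pn[r /sub_kermxP rM r0]; exists (r ord0) => [|j].
  have /rV0Pn[i ri] := r0; by exists i.
have /matrixP/(_ ord0 (enum_rank j)) := rM.
rewrite !mxE => {2}<-; apply: eq_bigr => i _.
by rewrite mxE enum_rankK.
Qed.

Section Homogeneity.
Context {R : realType} {Om : finType} (P : Om -> R).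
Hypothesis P0 : forall t, 0 <= P t.

(** The correction term does not depend on [f], so it cancels in [cent], which is therefore
    positively homogeneous. *)
Lemma ent_scale (A : eqType) (f : Om -> A) (l : R) : 0 <= l ->
  ent (fun t => l * P t) f = l * ent P f - l * ln l * \sum_t P t.
Proof.
rewrite le_eqVlt => /orP[/eqP <-|l0].
  rewrite /ent !mul0r subr0 big1 ?oppr0// => t _; by rewrite !mul0r.
rewrite /ent mulrN mulr_sumr mulr_sumr -opprD -big_split/=; congr (- _).
apply: eq_bigr => t _; have := P0 t; rewrite le_eqVlt => /orP[/eqP <-|Pt].
  by rewrite !(mulr0, mul0r) addr0.
rewrite /Pr -mulr_sumr -/(Pr P _) lnM ?posrE ?Pr_gt0//; ring.
Qed.

Lemma cent_scale (A B : eqType) (f : Om -> A) (g : Om -> B) (l : R) : 0 <= l ->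
  cent (fun t => l * P t) f g = l * cent P f g.
Proof. by move=> l0; rewrite /cent !ent_scale//; ring. Qed.

End Homogeneity.

(** Along one ultrafilter all bounded sequences converge, so every entry of the channels gets its
    limit at once, without successive extractions. *)
Lemma ultra_cvg01 (R : realType) (I : Type) (G : set_system I) (u : I -> R) :
  UltraFilter G -> (forall k, 0 <= u k <= 1) -> exists l : R, u k @[k --> G] --> l.
Proof.
move=> GU u01.
have UU : UltraFilter (u @ G).
  split; first exact: fmap_proper_filter.
  move=> H HP uGH; apply/seteqP; split=> // A HA.
  have [//|GnA] := in_ultra_setVsetC (u @^-1` A) GU.
  have /uGH HnA : (u @ G) (~` A) by [].
  by have [x []] := filter_ex (filterI HA HnA).
have := @segment_compact R 0 1; rewrite compact_ultra => /(_ _ UU)[].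
  by apply: nearW => k /=; rewrite in_itv/= u01.
by move=> l [_ ul]; exists l.
Qed.

(** Freezes the reconstruction function, which takes finitely many values once the alphabet of U is
    bounded, while the channels pass to the limit. *)
Lemma ultra_pigeonhole (I : Type) (V : finType) (G : set_system I) (h : I -> V) :
  UltraFilter G -> exists v, \forall k \near G, h k = v.
Proof.
move=> GU; apply: contrapT => /forallNP H.
have : \forall k \near G, forall v, h k <> v.
  apply: filter_forall => v.
  by have [] := in_ultra_setVsetC [set k | h k = v] GU => // /H.
by move=> /filter_ex[k /(_ (h k))].
Qed.

Section Source.
Context {R : realType} {T Xr Xh Zt : finType}.
Local Notation X := (Xr * Xh)%type.
Variables (p : T -> R) (a : T -> X) (z : T -> Zt) (d : Xr -> Xr -> R).
Hypotheses (p0 : forall t, 0 <= p t) (p1 : \sum_t p t = 1).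

(* [w] is one column [W(. , u)] of a channel, seen as an unnormalized
   posterior; the three quantities of a channel are sums over its columns of
   positively homogeneous functionals. *)
Definition colP (w : X -> R) (t : T) : R := p t * w (a t).

Definition col_dist (w : X -> R) (f : Zt -> Xr) : R :=
  \sum_t colP w t * d (a t).1 (f (z t)).

Lemma ent_columns (U : finType) (W : X -> U -> R) (A : eqType) (f : T -> A) :
  ent (sjoint p a W) (fun w => (w.2, f w.1)) = \sum_u ent (colP (W^~ u)) f.
Proof.
rewrite /ent sumrN; congr (- _).
transitivity (\sum_t \sum_u sjoint p a W (t, u) *
   ln (Pr (colP (W^~ u)) (fun s => f s == f t))); last by rewrite exchange_big.
rewrite pair_bigA/=; apply: eq_bigr => -[t u] _ /=; congr (_ * ln _).
rewrite /Pr big_mkcond [RHS]big_mkcond/=.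
transitivity (\sum_s \sum_v if (v, f s) == (u, f t) then sjoint p a W (s, v) else 0).
  by rewrite pair_bigA; apply: eq_bigr => -[].
apply: eq_bigr => s _; rewrite (bigD1 u)//= xpair_eqE eqxx/= big1 ?addr0//.
by move=> v vu; rewrite xpair_eqE (negbTE vu).
Qed.

Lemma cent_columns (U : finType) (W : X -> U -> R) (A B : eqType)
    (f : T -> A) (g : T -> B) :
  cent (sjoint p a W) (fun w => f w.1) (fun w => (w.2, g w.1)) =
  \sum_u cent (colP (W^~ u)) f g.
Proof.
rewrite /cent ent_columns sumrB; congr (_ - _).
rewrite -(ent_columns W (fun t => (f t, g t))); apply: ent_eq => s t.
by rewrite !xpair_eqE andbCA.
Qed.

Lemma sdist_columns (U : finType) (W : X -> U -> R) (phi : U -> Zt -> Xr) :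
  sdist p a z d W phi = \sum_u col_dist (W^~ u) (phi u).
Proof.
rewrite exchange_big/= pair_bigA/=; apply: eq_bigr => -[t u] _ //.
Qed.

Lemma colP_ge0 w : (forall x, 0 <= w x) -> forall t, 0 <= colP w t.
Proof. by move=> w0 t; rewrite mulr_ge0. Qed.

Lemma colP_scale (l : R) w : colP (fun x => l * w x) = fun t => l * colP w t.
Proof. by apply/funext => t; rewrite /colP mulrCA. Qed.

Lemma col_dist_scale (l : R) w f : col_dist (fun x => l * w x) f = l * col_dist w f.
Proof.
by rewrite /col_dist colP_scale mulr_sumr; apply: eq_bigr => t _; rewrite mulrA.
Qed.

(** [Q] is H(X | U, Z), from which [srateE] recovers the rate. The totals are equalities because
    these are what a linear dependency preserves. *)
Definition columns (n : nat) (D E Q : R) : Prop :=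
  exists (w : 'I_n -> X -> R) (f : 'I_n -> Zt -> Xr),
  [/\ forall i x, 0 <= w i x, forall x, \sum_i w i x = 1,
      \sum_i col_dist (w i) (f i) = D,
      \sum_i cent (colP (w i)) (snd \o a) z = E &
      \sum_i cent (colP (w i)) a z = Q].

(* Caratheodory: a linear dependency between the columns' contributions lets
   one rescale the columns, preserving all sums, until one of them vanishes. *)
Lemma columns_reduce n D E Q : (#|{: X}| + 3 < n.+1)%N ->
  columns n.+1 D E Q -> columns n D E Q.
Proof.
move=> Nn [w [f [w0 w1 HD HE HQ]]].
(* One coordinate per letter [x], for the normalization of the channel, and three for the distortion
   and the two conditional entropies. *)
pose v (i : 'I_n.+1) (j : X + 'I_3) : R := match j with
  | inl x => w i x
  | inr k => if k == 0%N :> nat then col_dist (w i) (f i) else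
             if k == 1%N :> nat then cent (colP (w i)) (snd \o a) z else
             cent (colP (w i)) a z end.
have [|c [i1 ci1] cv] := @exists_dependency R _ _ v.
  by rewrite card_sum card_ord.
pose i0 := [arg max_(i > i1) `|c i|]%O.
have [ci0 c_max] : c i0 != 0 /\ forall i, `|c i| <= `|c i0|.
  rewrite /i0; case: arg_maxP => // i _ H; split=> [|j]; last exact: H.
  by rewrite -normr_gt0 (lt_le_trans _ (H i1 _))// normr_gt0.
(* Since [c i0] has the largest modulus, every factor is nonnegative, and the factor of column [i0]
   is zero. *)
pose l i := 1 - c i / c i0.
have l0 i : 0 <= l i.
  rewrite subr_ge0; apply: le_trans (ler_norm _) _.
  by rewrite normrM normfV ler_pdivrMr ?normr_gt0// mul1r.
have li0 : l i0 = 0 by rewrite /l divff// subrr.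
have sumE j : \sum_(i < n) l (lift i0 i) * v (lift i0 i) j = \sum_i v i j.
  transitivity (\sum_i l i * v i j).
    by rewrite [RHS](@bigD1_ord _ _ _ _ i0 xpredT)//= li0 mul0r add0r.
  rewrite /l; under eq_bigr do rewrite mulrBl mul1r mulrAC.
  by rewrite sumrB -mulr_suml cv mul0r subr0.
have centE i (A B : eqType) (g : T -> A) (h : T -> B) :
    cent (colP (fun x => l i * w i x)) g h = l i * cent (colP (w i)) g h.
  by rewrite colP_scale cent_scale// => t; exact: colP_ge0.
exists (fun i x => l (lift i0 i) * w (lift i0 i) x), (fun i => f (lift i0 i)).
split.
- by move=> i x; rewrite mulr_ge0.
- by move=> x; rewrite (sumE (inl x)) /= w1.
- under eq_bigr do rewrite col_dist_scale.
  by have := sumE (inr (inord 0)); rewrite /= inordK//= => ->.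
- under eq_bigr do rewrite centE.
  by have := sumE (inr (inord 1)); rewrite /= inordK//= => ->.
- under eq_bigr do rewrite centE.
  by have := sumE (inr (inord 2)); rewrite /= inordK//= => ->.
Qed.

Lemma columns_pad n D E Q (xr0 : Xr) : columns n D E Q -> columns n.+1 D E Q.
Proof.
move=> [w [f [w0 w1 HD HE HQ]]].
exists (fun i x => if unlift ord0 i is Some j then w j x else 0).
exists (fun i => if unlift ord0 i is Some j then f j else fun=> xr0).
have P0 : colP (fun=> 0) = fun=> 0 by apply/funext => t; rewrite /colP mulr0.
have C0 (A B : eqType) (g : T -> A) (h : T -> B) : cent (fun=> 0 : R) g h = 0.
  rewrite /cent /ent big1 ?big1 ?subrr// => t _; by rewrite mul0r.
split.
- by move=> i x; case: unliftP.
- move=> x; rewrite big_ord_recl unlift_none add0r -[RHS](w1 x).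
  by apply: eq_bigr => i _; rewrite liftK.
- rewrite big_ord_recl unlift_none /= /col_dist P0 big1 ?add0r => [|t _]; last by rewrite mul0r.
  by rewrite -HD; apply: eq_bigr => i _; rewrite liftK.
- rewrite big_ord_recl unlift_none /= P0 C0 add0r -HE.
  by apply: eq_bigr => i _; rewrite liftK.
- rewrite big_ord_recl unlift_none /= P0 C0 add0r -HQ.
  by apply: eq_bigr => i _; rewrite liftK.
Qed.

(** Zero columns pad short lists, so that all test channels share one alphabet and can be compared
    entrywise. *)
Lemma columns_bounded n D E Q (xr0 : Xr) :
  columns n D E Q -> columns (#|{: X}| + 3) D E Q.
Proof.
have [nN|Nn] := leqP n (#|{: X}| + 3).
  by rewrite -(subnK nN); elim: (_ - _)%N => [//|m IH] /IH; exact: columns_pad.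
have -> : n = (n - (#|{: X}| + 3) + (#|{: X}| + 3))%N by rewrite subnK// ltnW.
elim: (n - _)%N => [//|m IH] H; apply: IH; apply: columns_reduce => //.
by rewrite ltnS leq_addl.
Qed.

Lemma channel_columns (U : finType) (W : X -> U -> R) (phi : U -> Zt -> Xr) :
  channel W -> columns #|U| (sdist p a z d W phi) (sequiv p a z W)
     (cent (sjoint p a W) (fun w => a w.1) (fun w => (w.2, z w.1))).
Proof.
move=> [W0 W1].
have rank (F : U -> R) : \sum_(i < #|U|) F (enum_val i) = \sum_u F u.
  rewrite (reindex (@enum_val U xpredT))//=.
  exists (@enum_rank U) => u _; [exact: enum_valK | exact: enum_rankK].
exists (fun i x => W x (enum_val i)), (fun i => phi (enum_val i)); split=> //.
- by move=> x; rewrite (rank (W x)).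
- by rewrite sdist_columns (rank (fun u => col_dist (W^~ u) (phi u))).
- rewrite /sequiv (cent_columns W (snd \o a) z).
  by rewrite (rank (fun u => cent (colP (W^~ u)) _ _)).
- rewrite (cent_columns W a z).
  by rewrite (rank (fun u => cent (colP (W^~ u)) _ _)).
Qed.

Definition single_letter (D E Q : R) : Prop :=
  exists (U : finType) (W : X -> U -> R) (phi : U -> Zt -> Xr),
  [/\ channel W, sdist p a z d W phi <= D, E <= sequiv p a z W &
      srate p a z W <= Q].

Theorem single_letter_closed D E Q :
  (forall e, 0 < e -> single_letter (D + e) (E - e) (Q + e)) ->
  single_letter D E Q.
Proof.
move=> H.
have xr0 : Xr.
  case: (pickP (fun _ : T => true)) => [t _|T0]; first exact: (a t).1.
  by exfalso; move: p1; rewrite big_pred0// => /eqP; rewrite eq_sym oner_eq0.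
pose N := (#|{: X}| + 3)%N.
pose e k : R := k.+1%:R^-1.
have e0 k : 0 < e k by rewrite invr_gt0.
(* The reconstruction is stored as a finite function so that it ranges over a finite type, as
   [ultra_pigeonhole] requires. *)
have /choice[wf Hwf] k : exists wf : ('I_N -> X -> R) * {ffun 'I_N -> {ffun Zt -> Xr}},
  [/\ forall i x, 0 <= wf.1 i x, forall x, \sum_i wf.1 i x = 1,
      \sum_i col_dist (wf.1 i) (wf.2 i) <= D + e k,
      E - e k <= \sum_i cent (colP (wf.1 i)) (snd \o a) z &
      cent p a z - (Q + e k) <= \sum_i cent (colP (wf.1 i)) a z].
  have [U [W [phi [Wk WD WE WQ]]]] := H _ (e0 k).
  have [w [f [w0 w1 HD HE HQ]]] := columns_bounded xr0 (channel_columns phi Wk).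
  exists (w, [ffun i => [ffun zz => f i zz]]) => /=; split=> //.
  - rewrite (le_trans _ WD)// -HD le_eqVlt; apply/orP; left; apply/eqP.
    apply: eq_bigr => i _; congr (col_dist _ _).
    by apply/funext => zz; rewrite !ffunE.
  - by rewrite HE.
  - by move: WQ; rewrite (srateE _ _ p0 Wk) HQ; lra.
have [G [GU ooG]] := @ultraFilterLemma nat \oo _.
have [phi Hphi] : exists phi : {ffun 'I_N -> {ffun Zt -> Xr}},
  \forall k \near G, (wf k).2 = phi by exact: ultra_pigeonhole.
have /choice[W HW] (xi : X * 'I_N) : exists l : R, (wf k).1 xi.2 xi.1 @[k --> G] --> l.
  apply: ultra_cvg01 => k; have [w0 w1 _ _ _] := Hwf k.
  rewrite w0/= -(w1 xi.1) (bigD1 xi.2)//= lerDl sumr_ge0//.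
have HW' i x : (wf k).1 i x @[k --> G] --> W (x, i) by exact: (HW (x, i)).
have W0 i x : 0 <= W (x, i).
  apply: (cvgr_to_ge (HW' i x)); apply: nearW => k.
  by have [w0 _ _ _ _] := Hwf k.
have eG : e k @[k --> G] --> 0.
  apply: cvg_trans (@cvg_harmonic R); exact: cvg_app.
have colG i t : colP ((wf k).1 i) t @[k --> G] --> colP (fun x => W (x, i)) t.
  by apply: cvgM => //; exact: cvg_cst.
have centG (A B : finType) (g : T -> A) (h : T -> B) :
   \sum_i cent (colP ((wf k).1 i)) g h @[k --> G] -->
   \sum_i cent (colP (fun x => W (x, i))) g h.
  apply: cvg_finsum => i; apply: cvg_cent => // [k t|t].
    by apply: colP_ge0 => x; have [w0 _ _ _ _] := Hwf k.
  exact: colP_ge0.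
have Wk : channel (fun x i => W (x, i)).
  split=> [x u|x]; first exact: W0.
  have S : \sum_i (wf k).1 i x @[k --> G] --> \sum_i W (x, i) by exact: cvg_finsum.
  apply/eqP; rewrite eq_le; apply/andP; split;
    [apply: (cvgr_to_le S)|apply: (cvgr_to_ge S)];
    by apply: nearW => k; have [_ ->] := Hwf k.
exists 'I_N, (fun x i => W (x, i)), (fun i zz => phi i zz); split=> //.
- rewrite sdist_columns.
  have distG : \sum_i col_dist ((wf k).1 i) (phi i) @[k --> G] -->
     \sum_i col_dist (fun x => W (x, i)) (phi i).
    apply: cvg_finsum => i; apply: cvg_finsum => t.
    by apply: cvgM => //; exact: cvg_cst.
  rewrite -[D in leRHS]addr0 -subr_ge0.
  apply: (cvgr_to_ge (cvgB (cvgD (cvg_cst D) eG) distG)).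
  apply: filterS Hphi => k <-; rewrite subr_ge0.
  by have [_ _ -> _ _] := Hwf k.
- rewrite /sequiv (cent_columns (fun x i => W (x, i)) (snd \o a) z) -subr_ge0.
  rewrite -[E in leRHS]subr0.
  apply: (cvgr_to_ge (cvgB (centG _ _ (snd \o a) z) (cvgB (cvg_cst E) eG))).
  by apply: nearW => k; rewrite subr_ge0; have [_ _ _ -> _] := Hwf k.
- rewrite (srateE _ _ p0 Wk)// (cent_columns (fun x i => W (x, i)) a z).
  rewrite lerBlDr -lerBlDl -subr_ge0.
  rewrite -[Q in leRHS]addr0.
  apply: (cvgr_to_ge (cvgB (centG _ _ a z)
    (cvgB (cvg_cst (cent p a z)) (cvgD (cvg_cst Q) eG)))).
  by apply: nearW => k; rewrite subr_ge0; have [_ _ _ _ ->] := Hwf k.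
Qed.

End Source.

(** * Chebyshev, covering and binning *)

Section Bounds.
Context {R : realType} {Om : finType} (P : Om -> R).
Hypothesis P0 : forall t, 0 <= P t.

Lemma PrE (E : pred Om) : Pr P E = \sum_t P t * (E t)%:R.
Proof. by rewrite /Pr big_mkcond; apply: eq_bigr => t _; rewrite mulr_natr mulrb. Qed.

Lemma Pr_or (E F : pred Om) : Pr P (fun t => E t || F t) <= Pr P E + Pr P F.
Proof.
rewrite !PrE -big_split/=; apply: ler_sum => t _; rewrite -mulrDr ler_wpM2l//.
by case: (E t); case: (F t); rewrite /= ?addr0 ?add0r// lerDl.
Qed.

Lemma Pr_exists (I : finType) (E : I -> pred Om) :
  Pr P (fun t => [exists i, E i t]) <= \sum_i Pr P (E i).
Proof.
rewrite PrE; under [leRHS]eq_bigr do rewrite PrE.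
rewrite exchange_big/=; apply: ler_sum => t _; rewrite -mulr_sumr ler_wpM2l//.
case: existsP => [[i Ei]|_]; last by apply: sumr_ge0.
by rewrite (bigD1 i)//= Ei lerDl sumr_ge0.
Qed.

Lemma Pr_markov (E : pred Om) (g : Om -> R) :
  (forall t, 0 <= g t) -> (forall t, 0 < P t -> E t -> 1 <= g t) -> Pr P E <= \sum_t P t * g t.
Proof.
move=> g0 g1; rewrite PrE; apply: ler_sum => t _.
have := P0 t; rewrite le_eqVlt => /orP[/eqP <-|Pt]; first by rewrite !mul0r.
rewrite ler_wpM2l//; case: (boolP (E t)) => [|_]; [exact: g1 | exact: g0].
Qed.

(** The probabilistic method, used for each new codeword and for the bin assignment. *)
Lemma exists_ge_average (g : Om -> R) (v : R) : \sum_t P t = 1 ->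
  v <= \sum_t P t * g t -> exists t, v <= g t.
Proof.
move=> P1 vg; apply/existsP; apply: contraT; rewrite negb_exists => /forallP gv.
have {}gv t : g t < v by rewrite ltNge gv.
have h t : 0 <= P t * (v - g t) by rewrite mulr_ge0// subr_ge0 ltW.
have S : \sum_t P t * (v - g t) <= 0.
  under eq_bigr do rewrite mulrBr.
  by rewrite sumrB -mulr_suml P1 mul1r subr_le0.
have : \sum_t P t = 0.
  apply: big1 => t _.
  have : P t * (v - g t) <= 0.
    by apply: le_trans S; rewrite (bigD1 t)//= lerDl sumr_ge0.
  move=> le0; have /eqP : P t * (v - g t) = 0 by apply/eqP; rewrite eq_le le0 h.
  by rewrite mulf_eq0 subr_eq0 [v == _]gt_eqF// orbF => /eqP.
by rewrite P1 => /eqP; rewrite oner_eq0.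
Qed.

End Bounds.

Section Chebyshev.
Context {R : realType} {T : finType} (p : T -> R).
Hypotheses (p0 : forall t, 0 <= p t) (p1 : \sum_t p t = 1).

Lemma chebyshev (I : finType) (f : T -> R) (mu e : R) : (0 < #|I|)%N -> 0 < e ->
  \sum_t p t * f t = mu ->
  Pr (@prodP R I T p) (fun s => #|I|%:R * e < `|\sum_i f (s i) - #|I|%:R * mu|) <=
  (\sum_t p t * (f t - mu) ^+ 2) / (#|I|%:R * e ^+ 2).
Proof.
move=> I0 e0 fmu; set n : R := #|I|%:R.
have n0 : 0 < n by rewrite ltr0n.
pose g t := f t - mu.
have gE (s : {ffun I -> T}) : \sum_i f (s i) - n * mu = \sum_i g (s i).
  rewrite sumrB; congr (_ - _); by rewrite sumr_const -(mulr_natl mu).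
have g_mean : \sum_t p t * g t = 0.
  under eq_bigr do rewrite mulrBr.
  by rewrite sumrB fmu -mulr_suml p1 mul1r subrr.
apply: (@le_trans _ _ (\sum_s prodP p s * ((\sum_(i : I) g (s i)) / (n * e)) ^+ 2)).
  apply: Pr_markov => [s|s|s _]; [exact: prodP_ge0|exact: sqr_ge0|].
  rewrite gE => H; rewrite -real_normK ?num_real//.
  rewrite -[leLHS](expr1n _ 2) lerXn2r ?nnegrE//.
  by rewrite normf_div (gtr0_norm (mulr_gt0 n0 e0)) ler_pdivlMr ?mulr_gt0// mul1r ltW.
have -> : \sum_s prodP p s * ((\sum_(i : I) g (s i)) / (n * e)) ^+ 2 =
   (\sum_s prodP p s * (\sum_(i : I) g (s i)) ^+ 2) / (n * e) ^+ 2.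
  by rewrite mulr_suml; apply: eq_bigr => s _; rewrite expr_div_n mulrA.
have -> : \sum_s prodP p s * (\sum_(i : I) g (s i)) ^+ 2 = n * \sum_t p t * g t ^+ 2.
  transitivity (\sum_(i : I) \sum_(j : I) \sum_s prodP p s * (g (s i) * g (s j))).
    transitivity (\sum_s \sum_(i : I) \sum_(j : I) prodP p s * (g (s i) * g (s j))).
      apply: eq_bigr => s _; rewrite expr2 mulr_suml mulr_sumr.
      by apply: eq_bigr => i _; rewrite !mulr_sumr.
    by rewrite exchange_big; apply: eq_bigr => i _; rewrite exchange_big.
  rewrite -[n in RHS]/(#|I|%:R) mulr_natl -sumr_const; apply: eq_bigr => i _.
  rewrite (bigD1 i)//= [X in _ + X]big1 ?addr0 => [|j ji].
    by rewrite (sum_prodP_coord p1 i (fun t => g t * g t)).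
  (* For [j] other than [i], the resampled letter is independent of the one at [j] and has mean
     zero: the cross term vanishes. *)
  rewrite (resample p1 i) exchange_big/= big1// => s _.
  under eq_bigr do rewrite upd_same [upd _ _ _ j]ffunE (negbTE ji) mulrAC mulrA.
  by rewrite -!mulr_suml g_mean !mul0r.
rewrite le_eqVlt; apply/orP; left; apply/eqP; rewrite /g.
by field; rewrite !gt_eqF.
Qed.

End Chebyshev.

Section OneShot.
Context {R : realType}.

(** As [q] dominates [c * K x] on good pairs, a word drawn from [q] covers on average at least [c]
    times (uncovered mass - [dl]). A word reaching this average shrinks the excess of the uncovered
    mass over [dl] by the factor [1 - c]. *)
Lemma covering (A B : finType) (PA : A -> R) (q : B -> R) (K : A -> B -> R)
    (good : A -> B -> bool) (c dl : R) (m : nat) (u0 : B) :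
  (forall x, 0 <= PA x) -> \sum_x PA x = 1 -> (forall u, 0 <= q u) -> \sum_u q u = 1 ->
  (forall x u, 0 <= K x u) -> (forall x, \sum_u K x u = 1) ->
  0 <= c <= 1 -> (forall x u, good x u -> c * K x u <= q u) ->
  0 <= dl -> \sum_x PA x * (\sum_u K x u * (~~ good x u)%:R) <= dl ->
  exists (C : 'I_m.+1 -> B) (L : A -> 'I_m.+1),
    Pr PA (fun x => ~~ good x (C (L x))) <= dl + (1 - c) ^+ m.
Proof.
move=> PA0 PA1 q0 q1 K0 K1 /andP[c0 c1] goodq dl0 bad.
pose unc (s : seq B) := Pr PA (fun x => ~~ has (good x) s).
suff [s sz us] : exists2 s : seq B, size s = m & unc s <= dl + (1 - c) ^+ m.
  (* When no word is good, [find] returns [size s = m]; the extra index [m] then points to the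
     default word [u0]. *)
  exists (fun l => nth u0 s l), (fun x => inord (find (good x) s)).
  apply: le_trans us; apply: le_Pr => // x; apply: contra => h.
  by rewrite inordK ?nth_find// ltnS -sz find_size.
elim: m => [|m [s sz us]].
  exists [::] => //; rewrite expr0 -[leLHS]add0r lerD//.
  by rewrite /unc PrE -[leRHS]PA1; apply: ler_sum => x _; rewrite /= mulr1.
pose g u := \sum_x PA x * (~~ has (good x) s && good x u)%:R.
have [u gu] : exists u, c * (unc s - dl) <= g u.
  apply: (exists_ge_average (P := q)) => //.
  apply: (@le_trans _ _ (\sum_u \sum_x PA x * (~~ has (good x) s)%:R * (c * (K x u * (good x u)%:R)))).
    rewrite exchange_big/=; under eq_bigr do rewrite -mulr_sumr -mulr_sumr mulrCA.
    rewrite -mulr_sumr ler_wpM2l// lerBlDr -lerBlDl.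
    apply: le_trans bad; rewrite /unc PrE -sumrB; apply: ler_sum => x _.
    have K1x : 1 - \sum_u K x u * (good x u)%:R = \sum_u K x u * (~~ good x u)%:R.
      rewrite -{1}(K1 x) -sumrB; apply: eq_bigr => u _.
      by case: (good x u); rewrite ?mulr1 ?mulr0 ?subrr ?subr0.
    rewrite -[X in X - _]mulr1 -mulrBr K1x -mulrA ler_wpM2l//.
    case: (has _ _); rewrite ?mul1r// mul0r.
    by apply: sumr_ge0 => u _; rewrite mulr_ge0.
  apply: ler_sum => u _; rewrite mulr_sumr; apply: ler_sum => x _.
  rewrite [leRHS]mulrCA -mulrA ler_wpM2l//.
  have := goodq x u; case: (good x u) => [/(_ isT)|_]; last by rewrite andbF !mulr0.
  by rewrite andbT mulr1; case: (has _ _); rewrite /= ?mulr0 ?mul0r ?mulr1 ?mul1r.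
exists (u :: s); first by rewrite /= sz.
have -> : unc (u :: s) = unc s - g u.
  rewrite /unc !PrE -sumrB; apply: eq_bigr => x _ /=; rewrite -mulrBr.
  by case: (good x u); case: (has _ _) => /=; rewrite ?subrr ?subr0.
apply: le_trans (_ : unc s - c * (unc s - dl) <= _); first by rewrite lerD2l lerN2.
have -> : unc s - c * (unc s - dl) = dl + (1 - c) * (unc s - dl) by ring.
rewrite lerD2l exprS ler_wpM2l ?subr_ge0// lerBlDl//.
Qed.

(** Under uniform random binning two distinct indices collide with probability 1/(M+1), as
    resampling the bin of [l] shows; some assignment does no worse than the mean. *)
Lemma binning (L : finType) (M : nat) (w : L -> L -> R) :
  (forall l k, 0 <= w l k) ->
  exists b : {ffun L -> 'I_M.+1},
    \sum_l \sum_(k | k != l) w l k * (b l == b k)%:R <=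
    M.+1%:R^-1 * \sum_l \sum_k w l k.
Proof.
move=> w0; pose q (_ : 'I_M.+1) : R := M.+1%:R^-1.
have q0 t : 0 <= q t by rewrite invr_ge0.
have q1 : \sum_t q t = 1.
  by rewrite sumr_const card_ord -(mulr_natl (M.+1%:R^-1)) divff// pnatr_eq0.
pose v (b : {ffun L -> 'I_M.+1}) := \sum_l \sum_(k | k != l) w l k * (b l == b k)%:R.
have [|b vb] := @exists_ge_average R _ (@prodP R L _ q) (fun s => prodP_ge0 q0 s)
   (fun b => - v b) (- (M.+1%:R^-1 * \sum_l \sum_k w l k)) (sum_prodP q1).
  under [leRHS]eq_bigr do rewrite mulrN.
  rewrite sumrN lerN2 /v.
  under [leLHS]eq_bigr do rewrite mulr_sumr.
  rewrite exchange_big/= mulr_sumr; apply: ler_sum => l _.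
  under [leLHS]eq_bigr do rewrite mulr_sumr.
  rewrite exchange_big/= mulr_sumr [leRHS](bigID (fun k => k != l))/=.
  rewrite -[leLHS]addr0 lerD//; last first.
    by apply: sumr_ge0 => k _; rewrite mulr_ge0// invr_ge0.
  apply: ler_sum => k kl.
  rewrite le_eqVlt; apply/orP; left; apply/eqP.
  rewrite (resample q1 l) exchange_big/=.
  transitivity (\sum_(b : {ffun L -> 'I_M.+1}) prodP q b * (M.+1%:R^-1 * w l k)); last first.
    by rewrite -mulr_suml (sum_prodP q1) mul1r.
  apply: eq_bigr => b _; rewrite (bigD1 (b k))//= upd_same ffunE (negbTE kl) eqxx mulr1.
  rewrite big1 ?addr0 => [|t tb]; first by rewrite /q; ring.
  by rewrite upd_same ffunE (negbTE kl) (negbTE tb) !mulr0.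
by exists b; rewrite -lerN2.
Qed.

End OneShot.

(** * Typicality and existence of codes *)

Lemma le_Pr_pos (R : realType) (Om : finType) (P : Om -> R) (E F : pred Om) :
  (forall t, 0 <= P t) -> (forall t, 0 < P t -> E t -> F t) -> Pr P E <= Pr P F.
Proof.
move=> P0 EF; rewrite !PrE; apply: ler_sum => t _.
have := P0 t; rewrite le_eqVlt => /orP[/eqP <-|Pt]; first by rewrite !mul0r.
rewrite ler_wpM2l//; have := EF t Pt.
by case: (E t) => [->|_] //; rewrite ler_nat.
Qed.

Lemma prodP_gt0 (R : realType) (I T : finType) (p : T -> R) (s : {ffun I -> T}) :
  (forall t, 0 <= p t) -> 0 < prodP p s -> forall i, 0 < p (s i).
Proof.
move=> p0 Ps i; rewrite lt_neqAle p0 andbT eq_sym; apply/negP => /eqP E.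
by move: Ps; rewrite /prodP (bigD1 i)//= E mul0r ltxx.
Qed.

(** * Information density and its concentration *)

Section InformationDensity.
Context {R : realType} {Om A B : finType} (P : Om -> R) (F : Om -> A) (G : Om -> B).
Hypotheses (P0 : forall t, 0 <= P t) (P1 : \sum_t P t = 1).

(** The likelihood ratio of the joint law to the product of its marginals; the usual information
    density is its logarithm. *)
Definition idens (x : A) (y : B) : R :=
  Pr P (fun w => (F w, G w) == (x, y)) /
  (Pr P (fun w => F w == x) * Pr P (fun w => G w == y)).

Lemma idens_ge0 x y : 0 <= idens x y.
Proof. by rewrite mulr_ge0 ?invr_ge0 ?mulr_ge0 ?Pr_ge0. Qed.

Lemma idens_gt0 w : 0 < P w -> 0 < idens (F w) (G w).
Proof.
move=> Pw; rewrite divr_gt0//; first exact: (Pr_gt0 P0 (fun w => (F w, G w)) Pw).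
by rewrite mulr_gt0 ?Pr_gt0.
Qed.

Lemma idens_mean : \sum_w P w * ln (idens (F w) (G w)) = ent P F - cent P F G.
Proof.
transitivity (\sum_w (P w * ln (Pr P (fun s => (F s, G s) == (F w, G w))) -
   P w * ln (Pr P (fun s => F s == F w)) - P w * ln (Pr P (fun s => G s == G w)))); last first.
  by rewrite !sumrB /cent /ent; ring.
apply: eq_bigr => w _.
have := P0 w; rewrite le_eqVlt => /orP[/eqP <-|Pw].
  by rewrite !mul0r !subr0.
have a1 := Pr_gt0 P0 (fun w => (F w, G w)) Pw.
have a2 := Pr_gt0 P0 F Pw.
have a3 := Pr_gt0 P0 G Pw.
rewrite /idens ln_div ?posrE ?mulr_gt0// [in LHS]lnM ?posrE//; ring.
Qed.

(** For fixed [y], P(F = x) times the ratio is P(F = x | G = y), with total 1, or 0 when [y] has no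
    mass. *)
Lemma idens_sum y : \sum_w P w * idens (F w) y <= 1.
Proof.
rewrite (partition_big F xpredT)//=.
set q := Pr P (fun w => G w == y).
apply: (@le_trans _ _ (\sum_x Pr P (fun w => (F w, G w) == (x, y)) / q)).
  apply: ler_sum => x _.
  rewrite (eq_bigr (fun w => P w * idens x y)); last by move=> w /eqP ->.
  rewrite -mulr_suml -/(Pr P (fun w => F w == x)) /idens -/q.
  have [->|p0] := eqVneq (Pr P (fun w => F w == x)) 0.
    by rewrite mul0r mulr_ge0 ?invr_ge0 ?Pr_ge0.
  by rewrite invfM mulrCA mulVKf.
rewrite -mulr_suml (_ : \sum_x _ = q).
  by have [->|q0] := eqVneq q 0; [rewrite mul0r|rewrite divff].
rewrite /q /Pr [RHS](partition_big F xpredT)//=; apply: eq_bigr => x _.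
by apply: eq_bigl => w; rewrite xpair_eqE andbC.
Qed.

Lemma idens_typical (n : nat) (e I : R) : (0 < n)%N -> 0 < e ->
  I = ent P F - cent P F G ->
  Pr (@prodP R 'I_n Om P) (fun v => ~~ (expR (n%:R * (I - e)) <=
     \prod_i idens (F (v i)) (G (v i)) <= expR (n%:R * (I + e)))) <=
  (\sum_w P w * (ln (idens (F w) (G w)) - I) ^+ 2) / (n%:R * e ^+ 2).
Proof.
move=> n0 e0 EI.
have c0 : (0 < #|'I_n|)%N by rewrite card_ord.
have := @chebyshev R Om P P0 P1 'I_n (fun w => ln (idens (F w) (G w))) I e c0 e0.
rewrite EI => /(_ idens_mean); rewrite -EI.
rewrite card_ord; apply: le_trans.
apply: le_Pr_pos => [v|v Pv]; first exact: prodP_ge0.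
have pos i := idens_gt0 (prodP_gt0 P0 Pv i).
have -> : \prod_i idens (F (v i)) (G (v i)) = expR (\sum_i ln (idens (F (v i)) (G (v i)))).
  rewrite expR_sum; apply: eq_bigr => i _; rewrite lnK// posrE; exact: pos.
rewrite !ler_expR; apply: contraR; rewrite -leNgt ler_norml.
rewrite mulrBr mulrDr => /andP[h1 h2]; apply/andP; split; lra.
Qed.

End InformationDensity.

Section Coding.
Context {R : realType} {T Xr Xh Zt U : finType}.
Local Notation X := (Xr * Xh)%type.
Variables (p : T -> R) (a : T -> X) (z : T -> Zt) (W : X -> U -> R).
Hypotheses (p0 : forall t, 0 <= p t) (p1 : \sum_t p t = 1) (Wk : channel W).

Local Notation J := (sjoint p a W).
Let aw (w : T * U) := a w.1.
Let zw (w : T * U) := z w.1.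
Let uw (w : T * U) := w.2.

Definition pU (u : U) : R := Pr J (fun w => w.2 == u).

Let J0 w : 0 <= J w. Proof. exact: sjoint_ge0. Qed.
Let J1 : \sum_w J w = 1. Proof. exact: sum_sjoint. Qed.

Lemma pU_ge0 u : 0 <= pU u. Proof. exact: Pr_ge0. Qed.

Lemma sum_pU : \sum_u pU u = 1.
Proof.
rewrite -J1 [RHS](partition_big snd xpredT)//=.
Qed.

(** Bayes' rule. It turns the upper bound on the density into the domination of [Kn] by the codeword
    law that [covering] asks for. *)
Lemma kernel_idens w : 0 < J w -> W (aw w) (uw w) = idens J aw uw (aw w) (uw w) * pU (uw w).
Proof.
move=> Jw; rewrite /idens.
have -> : Pr J (fun w' => (aw w', uw w') == (aw w, uw w)) =
          Pr J (fun w' => aw w' == aw w) * W (aw w) (uw w).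
  have -> : Pr J (fun w' => aw w' == aw w) = \sum_t p t * (a t == aw w)%:R.
    by rewrite PrE -(sum_sjoint_fst p a Wk).
  rewrite PrE -(pair_bigA _ (fun t u => J (t, u) * ((aw (t, u), uw (t, u)) == (aw w, uw w))%:R))/=.
  rewrite mulr_suml; apply: eq_bigr => t _.
  rewrite (bigD1 (uw w))//= big1 ?addr0 => [|u uu]; last first.
    by rewrite xpair_eqE (negbTE uu) andbF mulr0.
  rewrite /sjoint/= xpair_eqE eqxx andbT /aw/=.
  by case: eqP => [->|]; rewrite ?mulr1 ?mulr0 ?mul0r.
have h1 : Pr J (fun w' => aw w' == aw w) != 0 by rewrite gt_eqF// (Pr_gt0 J0 aw).
have h2 : pU (uw w) != 0 by rewrite gt_eqF// (Pr_gt0 J0 uw).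
by rewrite -/(pU (uw w)); field; rewrite h1 h2.
Qed.

Section Blocklength.
Context {n : nat}.
Local Notation Pn := (@prodP R 'I_n T p).
Local Notation Jn := (@prodP R 'I_n (T * U)%type J).

Definition Kn (x : {ffun 'I_n -> X}) (u : {ffun 'I_n -> U}) : R := \prod_i W (x i) (u i).
Definition PX (x : {ffun 'I_n -> X}) : R := Pr Pn (fun s => ffmap a s == x).

Let Pn0 s : 0 <= Pn s. Proof. exact: prodP_ge0. Qed.
Let Pn1 : \sum_s Pn s = 1. Proof. exact: sum_prodP. Qed.

Lemma Kn_ge0 x u : 0 <= Kn x u.
Proof. by apply: prodr_ge0 => i _; apply Wk. Qed.

Lemma sum_Kn x : \sum_u Kn x u = 1.
Proof.
rewrite /Kn -(bigA_distr_bigA (fun (i : 'I_n) u => W (x i) u)).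
by rewrite big1// => i _; exact: Wk.2.
Qed.

Lemma sum_PX (G : {ffun 'I_n -> X} -> R) : \sum_x PX x * G x = \sum_s Pn s * G (ffmap a s).
Proof.
rewrite [RHS](partition_big (ffmap a) xpredT)//=; apply: eq_bigr => x _.
by rewrite /PX /Pr mulr_suml; apply: eq_bigr => s /eqP ->.
Qed.

Lemma PX_ge0 x : 0 <= PX x. Proof. exact: Pr_ge0. Qed.

Lemma sum_PX1 : \sum_x PX x = 1.
Proof.
by have := sum_PX (fun=> 1); under eq_bigr do rewrite mulr1;
  under [in RHS]eq_bigr do rewrite mulr1; rewrite Pn1.
Qed.

Lemma sum_Jn (H : {ffun 'I_n -> T} -> {ffun 'I_n -> U} -> R) :
  \sum_s Pn s * (\sum_u Kn (ffmap a s) u * H s u) =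
  \sum_v Jn v * H (ffmap fst v) (ffmap snd v).
Proof.
under eq_bigr do rewrite mulr_sumr.
rewrite pair_bigA/=.
pose f (v : {ffun 'I_n -> T * U}) := (ffmap fst v, ffmap snd v).
pose g (su : {ffun 'I_n -> T} * {ffun 'I_n -> U}) : {ffun 'I_n -> T * U} :=
  [ffun i => (su.1 i, su.2 i)].
rewrite (reindex f)/=; last first.
  exists g => [v _|[s u] _]; rewrite /f /g/=.
    by apply/ffunP => i; rewrite !ffunE; case: (v i).
  by congr pair; apply/ffunP => i; rewrite !ffunE.
apply: eq_bigr => v _; rewrite mulrA; congr (_ * _).
by rewrite /prodP /Kn -big_split/=; apply: eq_bigr => i _; rewrite /sjoint !ffunE.
Qed.

Lemma sum_Jn_pred (B : {ffun 'I_n -> X} -> {ffun 'I_n -> U} -> bool) :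
  \sum_x PX x * (\sum_u Kn x u * (B x u)%:R) =
  Pr Jn (fun v => B (ffmap aw v) (ffmap uw v)).
Proof.
rewrite (sum_PX (fun x => \sum_u Kn x u * (B x u)%:R)).
rewrite (sum_Jn (fun s u => (B (ffmap a s) u)%:R)) PrE.
apply: eq_bigr => v _; congr (_ * (B _ _)%:R).
by apply/ffunP => i; rewrite !ffunE.
Qed.

Variable e : R.

Definition typ (u : {ffun 'I_n -> U}) (y : {ffun 'I_n -> Zt}) : bool :=
  expR (n%:R * (ent J zw - cent J zw uw - e)) <= \prod_i idens J zw uw (y i) (u i).

(** Markov's inequality: for a fixed word the product of ratios has mean at most 1, by [idens_sum].
    This is the chance that an unrelated word passes the decoder's test. *)
Lemma typ_independent u : Pr Pn (fun s => typ u (ffmap z s)) <=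
  expR (- (n%:R * (ent J zw - cent J zw uw - e))).
Proof.
set c := n%:R * _.
apply: (@le_trans _ _ (\sum_s Pn s * (expR (- c) * \prod_i idens J zw uw (z (s i)) (u i)))).
  apply: Pr_markov => // [s|s _].
    by rewrite mulr_ge0 ?expR_ge0// prodr_ge0// => i _; exact: idens_ge0.
  rewrite /typ -/c => h; rewrite expRN -ler_pdivrMl ?invr_gt0 ?expR_gt0//.
  rewrite invrK mulr1 (le_trans h)// le_eqVlt; apply/orP; left; apply/eqP.
  by apply: eq_bigr => i _; rewrite ffunE.
under eq_bigr do rewrite mulrCA.
rewrite -mulr_sumr ler_piMr ?expR_ge0//.
under eq_bigr do rewrite /prodP -big_split/=.
rewrite -(bigA_distr_bigA (fun i t => p t * idens J zw uw (z t) (u i))).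
apply: prodr_ile1 => i _; apply/andP; split.
  by apply: sumr_ge0 => t _; rewrite mulr_ge0 ?idens_ge0.
rewrite -(sum_sjoint_fst p a Wk (fun t => idens J zw uw (z t) (u i))).
exact: (idens_sum zw uw J0).
Qed.

Variable dl : R.
Hypotheses (n0 : (0 < n)%N) (e0 : 0 < e) (dl0 : 0 < dl).

Let I1 := ent J aw - cent J aw uw.
Let I2 := ent J zw - cent J zw uw.
Let N : R := n%:R.
Let N0 : 0 < N. Proof. by rewrite ltr0n. Qed.

Definition hit (w : T * U) (xu : X * U) : R := ((aw w == xu.1) && (uw w == xu.2))%:R.
Definition mean_hit (xu : X * U) : R := \sum_w J w * hit w xu.

Definition count_hit (x : {ffun 'I_n -> X}) (u : {ffun 'I_n -> U}) (xu : X * U) : R :=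
  \sum_i ((x i == xu.1) && (u i == xu.2))%:R.

(** Kept as a joint mass with the event X^n = x, so that nothing is divided by [PX x], which may
    vanish. *)
Definition atyp_mass (x : {ffun 'I_n -> X}) (u : {ffun 'I_n -> U}) : R :=
  \sum_(s | ffmap a s == x) Pn s * (~~ typ u (ffmap z s))%:R.

(* The third clause bounds the probability, given [x], that [u] is not jointly
   typical with the side information: it replaces the Markov lemma. *)
Definition good (x : {ffun 'I_n -> X}) (u : {ffun 'I_n -> U}) : bool :=
  [&& expR (- (N * (I1 + e))) * Kn x u <= prodP pU u,
      [forall xu, `|count_hit x u xu - N * mean_hit xu| <= N * e] &
      atyp_mass x u <= dl * PX x].

(** The variances of three Chebyshev bounds; the last is divided by [dl] because of Markov's
    inequality in [bad_atyp]. *)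
Definition bad_const : R :=
  ((\sum_w J w * (ln (idens J aw uw (aw w) (uw w)) - I1) ^+ 2) +
   (\sum_xu \sum_w J w * (hit w xu - mean_hit xu) ^+ 2) +
   (\sum_w J w * (ln (idens J zw uw (zw w) (uw w)) - I2) ^+ 2) / dl) / e ^+ 2.

Lemma bad_const_ge0 : 0 <= bad_const.
Proof.
have V (f : T * U -> R) : 0 <= \sum_w J w * f w ^+ 2.
  by apply: sumr_ge0 => w _; rewrite mulr_ge0// sqr_ge0.
rewrite divr_ge0 ?sqr_ge0// !addr_ge0// ?divr_ge0 ?(ltW dl0)//.
by apply: sumr_ge0.
Qed.

Let Jn0 v : 0 <= Jn v. Proof. exact: prodP_ge0. Qed.

Lemma bad_kernel :
  Pr Jn (fun v => ~~ (expR (- (N * (I1 + e))) * Kn (ffmap aw v) (ffmap uw v) <= prodP pU (ffmap uw v)))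
  <= (\sum_w J w * (ln (idens J aw uw (aw w) (uw w)) - I1) ^+ 2) / (N * e ^+ 2).
Proof.
apply: le_trans (idens_typical J0 J1 (F := aw) (G := uw) n0 e0 erefl).
apply: le_Pr_pos => // v Jv; apply: contra => /andP[_ h].
have -> : Kn (ffmap aw v) (ffmap uw v) =
   (\prod_i idens J aw uw (aw (v i)) (uw (v i))) * prodP pU (ffmap uw v).
  rewrite /Kn /prodP -big_split/=; apply: eq_bigr => i _.
  by rewrite !ffunE kernel_idens//; exact: (prodP_gt0 J0 Jv).
rewrite mulrA ler_piMl ?prodr_ge0 => // [i _|]; first by rewrite ?ffunE pU_ge0.
by rewrite expRN mulrC ler_pdivrMr ?expR_gt0// mul1r.
Qed.

Lemma bad_count :
  Pr Jn (fun v => ~~ [forall xu, `|count_hit (ffmap aw v) (ffmap uw v) xu - N * mean_hit xu| <= N * e])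
  <= (\sum_xu \sum_w J w * (hit w xu - mean_hit xu) ^+ 2) / (N * e ^+ 2).
Proof.
rewrite mulr_suml.
apply: (@le_trans _ _ (\sum_xu Pr Jn (fun v =>
   N * e < `|count_hit (ffmap aw v) (ffmap uw v) xu - N * mean_hit xu|))).
  apply: le_trans (Pr_exists _ _) => //; apply: le_Pr => // v.
  by rewrite negb_forall => /existsP[xu h]; apply/existsP; exists xu; rewrite ltNge.
apply: ler_sum => xu _.
have c0 : (0 < #|'I_n|)%N by rewrite card_ord.
have := @chebyshev R _ J J0 J1 'I_n (fun w => hit w xu) (mean_hit xu) e c0 e0 erefl.
rewrite card_ord -/N; apply: le_trans; apply: le_Pr => // v.
rewrite /count_hit; under eq_bigr do rewrite !ffunE.
by [].
Qed.

Lemma bad_typ :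
  Pr Jn (fun v => ~~ typ (ffmap uw v) (ffmap zw v))
  <= (\sum_w J w * (ln (idens J zw uw (zw w) (uw w)) - I2) ^+ 2) / (N * e ^+ 2).
Proof.
apply: le_trans (idens_typical J0 J1 (F := zw) (G := uw) n0 e0 erefl).
apply: le_Pr => // v; apply: contra => /andP[h _].
rewrite /typ (le_trans h)// le_eqVlt; apply/orP; left; apply/eqP.
by apply: eq_bigr => i _; rewrite !ffunE.
Qed.

Lemma bad_atyp :
  \sum_x PX x * (\sum_u Kn x u * (~~ (atyp_mass x u <= dl * PX x))%:R) <=
  Pr Jn (fun v => ~~ typ (ffmap uw v) (ffmap zw v)) / dl.
Proof.
have -> : Pr Jn (fun v => ~~ typ (ffmap uw v) (ffmap zw v)) =
   \sum_x \sum_u Kn x u * atyp_mass x u.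
  transitivity (\sum_s Pn s * (\sum_u Kn (ffmap a s) u * (~~ typ u (ffmap z s))%:R)).
    rewrite (sum_Jn (fun s u => (~~ typ u (ffmap z s))%:R)) PrE.
    apply: eq_bigr => v _; congr (_ * (~~ typ _ _)%:R).
    by apply/ffunP => i; rewrite !ffunE.
  rewrite (partition_big (ffmap a) xpredT)//=; apply: eq_bigr => x _.
  under eq_bigr => s /eqP -> do rewrite mulr_sumr.
  rewrite exchange_big/=; apply: eq_bigr => u _.
  by rewrite /atyp_mass mulr_sumr; apply: eq_bigr => s _; rewrite mulrCA.
rewrite mulr_suml; apply: ler_sum => x _; rewrite mulr_suml mulr_sumr.
apply: ler_sum => u _; rewrite mulrCA -mulrA ler_wpM2l ?Kn_ge0//.
have ge0 : 0 <= atyp_mass x u by apply: sumr_ge0 => s _; rewrite mulr_ge0.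
case: (leP (atyp_mass x u) (dl * PX x)) => [_|h]; first by rewrite mulr0 divr_ge0 ?(ltW dl0).
by rewrite mulr1 ler_pdivlMr// mulrC ltW.
Qed.

Lemma bad_good :
  \sum_x PX x * (\sum_u Kn x u * (~~ good x u)%:R) <= bad_const / N.
Proof.
pose g1 (x : {ffun 'I_n -> X}) u := expR (- (N * (I1 + e))) * Kn x u <= prodP pU u.
pose g2 x u := [forall xu, `|count_hit x u xu - N * mean_hit xu| <= N * e].
pose g3 x u := atyp_mass x u <= dl * PX x.
rewrite (sum_Jn_pred (fun x u => ~~ good x u)).
apply: (@le_trans _ _ (Pr Jn (fun v => ~~ g1 (ffmap aw v) (ffmap uw v)) +
   (Pr Jn (fun v => ~~ g2 (ffmap aw v) (ffmap uw v)) +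
    Pr Jn (fun v => ~~ g3 (ffmap aw v) (ffmap uw v))))).
  apply: le_trans (lerD (lexx _) (Pr_or Jn0 _ _)).
  apply: le_trans (Pr_or Jn0 _ _); apply: le_Pr => // v.
  by rewrite /good !negb_and.
rewrite -(sum_Jn_pred (fun x u => ~~ g3 x u)).
have h3 := le_trans bad_atyp (ler_wpM2r _ bad_typ).
apply: le_trans (lerD bad_kernel (lerD bad_count (h3 _))) _.
  by rewrite invr_ge0 ltW.
rewrite le_eqVlt; apply/orP; left; apply/eqP; rewrite /bad_const.
by field; rewrite !gt_eqF.
Qed.

Section Code.
Context {m M : nat}.
Variables (C : 'I_m.+1 -> {ffun 'I_n -> U}) (L : {ffun 'I_n -> X} -> 'I_m.+1)
  (b : 'I_m.+1 -> 'I_M.+1).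

Definition decodable (s : {ffun 'I_n -> T}) : bool :=
  let l := L (ffmap a s) in
  typ (C l) (ffmap z s) &&
  [forall k, (k != l) && (b k == b l) ==> ~~ typ (C k) (ffmap z s)].

(** The expected joint type of X^n and its codeword. It is the joint law of (X, U) under the channel
    induced by the code, which it thereby controls. *)
Definition type_of_code (xu : X * U) : R :=
  \sum_s Pn s * (N^-1 * count_hit (ffmap a s) (C (L (ffmap a s))) xu).

End Code.

Lemma code_exists (m M : nat) (u0 : U) :
  let E1 := bad_const / N + (1 - expR (- (N * (I1 + e)))) ^+ m in
  0 <= I1 ->
  exists (C : 'I_m.+1 -> {ffun 'I_n -> U}) (L : {ffun 'I_n -> X} -> 'I_m.+1)
     (b : 'I_m.+1 -> 'I_M.+1),
  (forall xu, `|type_of_code C L xu - mean_hit xu| <= e + E1) /\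
  Pr Pn (fun s => ~~ decodable C L b s) <=
    E1 + dl + m.+1%:R / M.+1%:R * expR (- (N * (I2 - e))).
Proof.
move=> E1 I10.
have pUn0 : forall u : {ffun 'I_n -> U}, 0 <= prodP pU u by move=> u; exact: (prodP_ge0 pU_ge0).
have [||C [L hCL]] := @covering R _ _ PX (prodP pU) Kn good (expR (- (N * (I1 + e))))
  (bad_const / N) m [ffun=> u0] PX_ge0 sum_PX1 pUn0 (sum_prodP sum_pU) Kn_ge0 sum_Kn _ _
  (divr_ge0 bad_const_ge0 (ltW N0)) bad_good.
- rewrite expR_ge0 expR_le1 oppr_le0; apply: mulr_ge0 (ltW N0) _.
  exact: addr_ge0 I10 (ltW e0).
- by move=> x u /and3P[].
rewrite -/E1 in hCL.
have E10 : 0 <= E1 by apply: le_trans hCL; exact: Pr_ge0 PX_ge0 _.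
have dist01 (x y : R) : 0 <= x <= 1 -> 0 <= y <= 1 -> `|x - y| <= e + 1.
  have := e0 => e_gt0 /andP[? ?] /andP[? ?]; rewrite ler_norml; apply/andP; split; lra.
pose gs s := good (ffmap a s) (C (L (ffmap a s))).
have hgs : Pr Pn (fun s => ~~ gs s) <= E1.
  apply: le_trans hCL; rewrite !PrE.
  by rewrite (sum_PX (fun x => (~~ good x (C (L x)))%:R)).
(* The chance that [l] is selected while [k] passes the test. Summed over [l] it is the chance that
   [k] passes, which [typ_independent] bounds. *)
pose w (l k : 'I_m.+1) : R :=
  \sum_s Pn s * ((L (ffmap a s) == l) && typ (C k) (ffmap z s))%:R.
have w0 l k : 0 <= w l k by apply: sumr_ge0 => s _; rewrite mulr_ge0.
have [b hb] := @binning R _ M w w0.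
exists C, L, b; split.
  move=> xu; rewrite /type_of_code.
  have -> : mean_hit xu = \sum_s Pn s * mean_hit xu by rewrite -mulr_suml Pn1 mul1r.
  rewrite -sumrB; under eq_bigr do rewrite -mulrBr.
  apply: le_trans (ler_norm_sum _ _ _) _.
  (* A good pair deviates by at most [e]; a bad one by at most [e + 1], since both quantities lie in
     [0, 1]. *)
  apply: le_trans (_ : \sum_s Pn s * (e + (~~ gs s)%:R) <= _); last first.
    under eq_bigr do rewrite mulrDr.
    by rewrite big_split/= -mulr_suml Pn1 mul1r lerD2l -PrE.
  apply: ler_sum => s _; rewrite normrM ger0_norm// ler_wpM2l//.
  case: (boolP (gs s)) => [/and3P[_ /forallP/(_ xu) h _]|_]; rewrite /= ?addr0.
    rewrite (_ : _ - _ = (count_hit (ffmap a s) (C (L (ffmap a s))) xu - N * mean_hit xu) / N); last first.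
      by field; rewrite gt_eqF.
    by rewrite normf_div (gtr0_norm N0) ler_pdivrMr// (mulrC e).
  have c01 : 0 <= N^-1 * count_hit (ffmap a s) (C (L (ffmap a s))) xu <= 1.
    rewrite mulr_ge0 ?invr_ge0 ?(ltW N0) ?sumr_ge0//= ler_pdivrMl// mulr1.
    rewrite /count_hit /N -[n in leRHS]card_ord -sumr_const.
    by apply: ler_sum => i _; case: (_ && _).
  have m01 : 0 <= mean_hit xu <= 1.
    rewrite sumr_ge0/=; last by move=> v _; rewrite mulr_ge0.
    rewrite -J1; apply: ler_sum => v _; rewrite -[leRHS]mulr1 ler_wpM2l//.
    by rewrite /hit; case: (_ && _).
  exact: dist01.
(* Three failures: the selected word is not good, it is good but fails the test with Z^n, or another
   word of its bin passes. *)
pose t1 s := ~~ gs s.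
pose t2 s := gs s && ~~ typ (C (L (ffmap a s))) (ffmap z s).
pose t3 s := [exists k, [&& k != L (ffmap a s), b k == b (L (ffmap a s)) & typ (C k) (ffmap z s)]].
apply: (@le_trans _ _ (Pr Pn t1 + Pr Pn t2 + Pr Pn t3)).
  apply: le_trans (lerD (Pr_or Pn0 _ _) (lexx _)).
  apply: le_trans (Pr_or Pn0 _ _); apply: le_Pr => // s.
  rewrite /decodable negb_and negb_forall /t1 /t2 => /orP[->|].
    by rewrite andbT orNb.
  move=> /existsP[k]; rewrite negb_imply negbK -andbA => h.
  by apply/orP; right; apply/existsP; exists k.
rewrite !lerD//.
  apply: (@le_trans _ _ (\sum_x dl * PX x)); last by rewrite -mulr_sumr sum_PX1 mulr1.
  rewrite PrE (partition_big (ffmap a) xpredT)//=; apply: ler_sum => x _.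
  case: (boolP (good x (C (L x)))) => [|ng]; last first.
    rewrite big1 ?mulr_ge0 ?(ltW dl0) ?PX_ge0// => s /eqP sx.
    by rewrite /t2 /gs sx (negbTE ng) mulr0.
  move=> /and3P[_ _]; apply: le_trans; apply: ler_sum => s /eqP sx.
  by rewrite ler_wpM2l// /t2 sx; case: (gs s).
apply: (@le_trans _ _ (\sum_l \sum_(k | k != l) w l k * (b l == b k)%:R)).
  rewrite PrE.
  have -> : \sum_l \sum_(k | k != l) w l k * (b l == b k)%:R =
    \sum_s Pn s * \sum_l \sum_(k | k != l)
      ((L (ffmap a s) == l) && typ (C k) (ffmap z s))%:R * (b l == b k)%:R.
    under [RHS]eq_bigr do rewrite mulr_sumr.
    rewrite [RHS]exchange_big/=; apply: eq_bigr => l _.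
    under [RHS]eq_bigr do rewrite mulr_sumr.
    rewrite [RHS]exchange_big/=; apply: eq_bigr => k _.
    by rewrite /w mulr_suml; apply: eq_bigr => s _; rewrite mulrA.
  apply: ler_sum => s _; rewrite ler_wpM2l//.
  have S0 (l : 'I_m.+1) : 0 <= \sum_(k | k != l)
      ((L (ffmap a s) == l) && typ (C k) (ffmap z s))%:R * (b l == b k)%:R :> R.
    by apply: sumr_ge0 => k _; rewrite mulr_ge0.
  rewrite /t3; case: existsP => [[k /and3P[k1 k2 k3]]|_]; last by rewrite sumr_ge0.
  rewrite (bigD1 (L (ffmap a s)))//= (bigD1 k)//= eqxx k3 eq_sym k2 mulr1.
  by rewrite -[leLHS]addr0 -[leLHS]addr0 !lerD ?sumr_ge0// => j _; rewrite mulr_ge0.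
apply: (le_trans hb).
rewrite [m.+1%:R / _]mulrC -mulrA ler_wpM2l ?invr_ge0//.
rewrite exchange_big/= -[m in leRHS]/(m.+1.-1) -[m.+1 in leRHS]card_ord mulr_natl -sumr_const.
apply: ler_sum => k _; apply: le_trans (typ_independent (C k)).
rewrite PrE exchange_big/=; apply: ler_sum => s _.
rewrite -mulr_sumr ler_wpM2l// (bigD1 (L (ffmap a s)))//= eqxx/= big1 ?addr0// => l.
by rewrite eq_sym => /negbTE ->.
Qed.

End Blocklength.

End Coding.

(** * Achievability *)

Lemma expR_inv_le (R : realType) (t : R) : 0 < t -> expR (- t) <= t^-1.
Proof.
move=> t0; rewrite expRN lef_pV2 ?posrE ?expR_gt0//.
by apply: le_trans (expR_ge1Dx t); rewrite lerDr.
Qed.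

Lemma chain_bound (R : realDomainType) (A B E D y c1 c2 : R) :
  A <= c2 -> E <= c1 -> D <= y -> A + B + E + D - y - c1 - c2 <= B.
Proof. lra. Qed.

(** With m just above e^{N(I+2r)}, (1 - c)^m <= exp(-c m) for c = e^{-N(I+r)}, and c m >= e^{Nr} >=
    N r. The third [r] absorbs the rounding: m + 1 is at most three times e^{N(I+2r)}, and 3 <=
    e^{Nr}. *)
Lemma codebook_size (R : realType) (N r I : R) : 0 <= N -> 0 < r -> 0 <= I -> 2 <= N * r ->
  exists m, (1 - expR (- (N * (I + r)))) ^+ m <= (N * r)^-1 /\
            m.+1%:R <= expR (N * (I + 3 * r)).
Proof.
move=> N0 r0 I0 Nr; have Nr0 : 0 < N * r by apply: lt_le_trans Nr; rewrite ltr0n.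
have NI : 0 <= N * I by rewrite mulr_ge0.
pose x := expR (N * (I + 2 * r)).
have x1 : 1 <= x.
  by rewrite -[leLHS](@expR0 R) ler_expR mulr_ge0// addr_ge0// mulr_ge0// ltW.
have /andP[t1 t2] := truncn_itv (le_trans ler01 x1).
have ex : 1 + N * r <= expR (N * r) by exact: expR_ge1Dx.
exists (Num.truncn x).+1; split; last first.
  apply: (@le_trans _ _ (expR (N * r) * x)); last first.
    by rewrite -expRD ler_expR; lra.
  apply: (@le_trans _ _ (3 * x)); last by rewrite ler_wpM2r ?expR_ge0//; lra.
  by rewrite -!natr1; lra.
have c1 : expR (- (N * (I + r))) <= 1.
  by rewrite expR_le1 oppr_le0 mulr_ge0// addr_ge0// ltW.
apply: le_trans (expR_inv_le Nr0).
apply: le_trans (_ : expR (- expR (- (N * (I + r)))) ^+ (Num.truncn x).+1 <= _).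
  rewrite lerXn2r ?nnegrE ?expR_ge0 ?subr_ge0//.
  exact: expR_ge1Dx.
rewrite -expRM_natr ler_expR mulNr lerN2.
apply: (@le_trans _ _ (expR (- (N * (I + r))) * x)); last first.
  by rewrite ler_wpM2l ?expR_ge0// ltW.
rewrite /x -expRD (_ : - (N * (I + r)) + N * (I + 2 * r) = N * r); last by ring.
lra.
Qed.

(** The excess [5 * r] beats the [3 * r] of the codebook and the [r] of the test, leaving a
    collision bound e^{-Nr}; the sixth [r] pays for rounding. *)
Lemma bin_number (R : realType) (N r S : R) : 0 <= N -> 0 < r -> 0 <= S -> 2 <= N * r ->
  exists M, expR (N * (S + 5 * r)) <= M.+1%:R <= expR (N * (S + 6 * r)).
Proof.
move=> N0 r0 S0 Nr; have NS : 0 <= N * S by rewrite mulr_ge0.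
pose x := expR (N * (S + 5 * r)).
have x1 : 1 <= x.
  by rewrite -[leLHS](@expR0 R) ler_expR mulr_ge0// addr_ge0// mulr_ge0// ltW.
have /andP[t1 t2] := truncn_itv (le_trans ler01 x1).
have ex : 1 + N * r <= expR (N * r) by exact: expR_ge1Dx.
exists (Num.truncn x); apply/andP; split; first exact: ltW.
apply: (@le_trans _ _ (expR (N * r) * x)); last by rewrite -expRD ler_expR; lra.
apply: (@le_trans _ _ (2 * x)); last by rewrite ler_wpM2r ?expR_ge0//; lra.
by rewrite -natr1; lra.
Qed.

Section Achievability.
Context {R : realType} {T Xr Xh Zt U : finType}.
Local Notation X := (Xr * Xh)%type.
Variables (p : T -> R) (a : T -> X) (z : T -> Zt) (W : X -> U -> R).
Hypotheses (p0 : forall t, 0 <= p t) (p1 : \sum_t p t = 1) (Wk : channel W).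

Local Notation J := (sjoint p a W).
Let I1 := ent J (fun w => a w.1) - cent J (fun w => a w.1) (fun w => w.2).
Let I2 := ent J (fun w => z w.1) - cent J (fun w => z w.1) (fun w => w.2).
Let J0 w : 0 <= J w. Proof. exact: sjoint_ge0. Qed.
Let J1 : \sum_w J w = 1. Proof. exact: sum_sjoint. Qed.

Lemma srate_ge0 : 0 <= srate p a z W.
Proof.
rewrite (srateE _ _ p0 Wk) subr_ge0.
have -> : cent p a z = cent J (fun w => a w.1) (fun w => z w.1).
  rewrite /cent (ent_sjoint_fst p a Wk z).
  by rewrite -(ent_sjoint_fst p a Wk (fun t => (a t, z t))).
exact: cent_mono.
Qed.

Lemma coding_rates (e : R) : 0 < e -> exists (n m M : nat)
    (C : 'I_m.+1 -> {ffun 'I_n -> U}) (L : {ffun 'I_n -> X} -> 'I_m.+1)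
    (b : 'I_m.+1 -> 'I_M.+1) (e' : R),
  [/\ (0 < n)%N,
      forall xu, `|type_of_code p a C L xu - mean_hit p a W xu| <= e,
      Pr (@prodP R 'I_n T p) (fun s => ~~ decodable p a z W e' C L b s) <= e,
      ln m.+1%:R <= n%:R * (I1 + e) &
      ln M.+1%:R <= n%:R * (srate p a z W + e)].
Proof.
(* The largest excess spent is [6 * r], in the bin rate. *)
move=> e_gt0; pose r := e / 6; have r0 : 0 < r by rewrite divr_gt0.
have [u0] : exists u0 : U, True.
  case: (pickP (fun _ : T * U => true)) => [w _|E]; first by exists w.2.
  by move: J1; rewrite big_pred0// => /eqP; rewrite eq_sym oner_eq0.
move=> _.
pose K := bad_const p a z W r r.
have K0 : 0 <= K by exact: bad_const_ge0.
(* One summand for each requirement on n: K / n <= r, 1 / (n r) <= r and 2 <= n r. *)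
pose B := K / r + (1 / r ^+ 2 + 2 / r).
have r2 : 0 < r ^+ 2 by rewrite exprn_gt0.
have B1 : 0 <= K / r by rewrite divr_ge0// ltW.
have B2 : 0 <= 1 / r ^+ 2 by rewrite divr_ge0// ltW.
have B3 : 0 <= 2 / r by rewrite divr_ge0// ltW.
have B0 : 0 <= B by rewrite /B; lra.
pose n := (Num.truncn B).+1.
have nB : B < n%:R by have /andP[] := truncn_itv B0.
have n0 : (0 < n)%N by [].
set N : R := n%:R in nB; have N0 : 0 < N by rewrite ltr0n.
have h1 : K / N <= r.
  by rewrite ler_pdivrMr// mulrC -ler_pdivrMr//; move: nB; rewrite /B; lra.
have h2 : (N * r)^-1 <= r.
  rewrite -[leLHS]mul1r ler_pdivrMr ?mulr_gt0// mulrCA -expr2 -ler_pdivrMr//.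
  by move: nB; rewrite /B; lra.
have h3 : 2 <= N * r by rewrite -ler_pdivrMr//; move: nB; rewrite /B; lra.
have I10 : 0 <= I1 by rewrite subr_ge0; exact: cent_le_ent.
have S0 := srate_ge0.
have [m [m1 m2]] := codebook_size (ltW N0) r0 I10 h3.
have [M /andP[M1 M2]] := bin_number (ltW N0) r0 S0 h3.
have [C [L [b [Ht Hd]]]] := code_exists z p0 p1 Wk n0 r0 r0 m M u0 I10.
exists n, m, M, C, L, b, r.
have E1 : bad_const p a z W r r / N + (1 - expR (- (N * (I1 + r)))) ^+ m <= 2 * r.
  by have := le_trans m1 h2; move: h1; rewrite -/K; lra.
have e6 : e = 6 * r by rewrite /r; field.
split=> //.
- move=> xu; apply: le_trans (Ht xu) _.
  have E1' : r + 2 * r <= e by lra.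
  by apply: le_trans E1'; rewrite lerD2l.
- apply: (le_trans Hd).
  have E3 : m.+1%:R / M.+1%:R * expR (- (N * (I2 - r))) <= r.
    apply: le_trans h2; apply: le_trans (expR_inv_le (lt_le_trans _ h3)); last by rewrite ltr0n.
    have -> : - (N * r) = (N * (I1 + 3 * r) - N * (srate p a z W + 5 * r)) + - (N * (I2 - r)).
      by rewrite (_ : srate p a z W = I1 - I2)//; ring.
    rewrite [leRHS]expRD ler_wpM2r ?expR_ge0// expRB.
    rewrite ler_pM ?invr_ge0 ?lef_pV2 ?posrE ?expR_gt0//.
  have E4 : 2 * r + r + r <= e by lra.
  by apply: le_trans E4; rewrite !lerD.
- rewrite -[leRHS]expRK ler_ln ?posrE ?expR_gt0//; apply: le_trans m2 _.
  by rewrite ler_expR ler_wpM2l ?(ltW N0)// lerD2l e6; lra.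
- rewrite -[leRHS]expRK ler_ln ?posrE ?expR_gt0//; apply: le_trans M2 _.
  by rewrite e6.
Qed.

Section CodeAnalysis.
Context {n m M : nat}.
Variables (C : 'I_m.+1 -> {ffun 'I_n -> U}) (L : {ffun 'I_n -> X} -> 'I_m.+1)
  (b : 'I_m.+1 -> 'I_M.+1) (e' : R).
Variables (d : Xr -> Xr -> R) (phi : U -> Zt -> Xr).
Hypotheses (n0 : (0 < n)%N) (d0 : forall x y, 0 <= d x y).

Local Notation Pn := (@prodP R 'I_n T p).
Let Pn0 s : 0 <= Pn s. Proof. exact: prodP_ge0. Qed.
Let Pn1 : \sum_s Pn s = 1. Proof. exact: sum_prodP. Qed.
Let N0 : 0 < n%:R :> R. Proof. by rewrite ltr0n. Qed.
Let In0 : (0 < #|'I_n|)%N. Proof. by rewrite card_ord. Qed.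

Definition code_enc (x : {ffun 'I_n -> X}) : 'I_M.+1 := b (L x).

(** The default [ord0] is reached only when no word of the bin passes the test, which is already a
    failure of [decodable]. *)
Definition code_dec (j : 'I_M.+1) (y : {ffun 'I_n -> Zt}) : {ffun 'I_n -> Xr} :=
  let l := odflt ord0 [pick l | (b l == j) && typ p a z W e' (C l) y] in
  [ffun i => phi (C l i) (y i)].

Lemma decode_correct s : decodable p a z W e' C L b s ->
  code_dec (code_enc (ffmap a s)) (ffmap z s) =
  [ffun i => phi (C (L (ffmap a s)) i) (z (s i))].
Proof.
move=> /andP[tL /forallP uL]; rewrite /code_dec /code_enc.
case: pickP => [l /andP[bl tl]|/(_ (L (ffmap a s)))]; last by rewrite eqxx tL.
have [->|ne] := eqVneq l (L (ffmap a s)).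
  by apply/ffunP => i; rewrite !ffunE.
by have := uL l; rewrite ne bl tl.
Qed.

(** Writing [x] at position [i] before selecting the word makes the letter independent of [s i], the
    form that [sum_induced] needs. *)
Definition code_word (i : 'I_n) (x : X) (s : {ffun 'I_n -> T}) : U :=
  C (L (upd (ffmap a s) i x)) i.

Lemma code_word_upd i x s t : code_word i x (upd s i t) = code_word i x s.
Proof. by rewrite /code_word ffmap_upd upd_upd. Qed.

Lemma code_wordE i (s : {ffun 'I_n -> T}) :
  code_word i (a (s i)) s = C (L (ffmap a s)) i.
Proof. by rewrite /code_word -ffmap_upd upd_id. Qed.

Local Notation codeW := (induced_channel p code_word).

Lemma code_channel : channel codeW.
Proof. exact: induced_channelP. Qed.

(** The double sum is a crude bound on the largest distortion, paid only when decoding fails;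
    otherwise the reconstruction is [phi] of the codeword letters. *)
Lemma code_dist_le : code_dist p a z d code_enc code_dec <=
  sdist p a z d codeW phi +
  (\sum_x \sum_y d x y) * Pr Pn (fun s => ~~ decodable p a z W e' C L b s).
Proof.
rewrite /sdist (sum_induced _ p1 code_word_upd) sum_mixP card_ord /=.
rewrite exchange_big/= mulr_sumr PrE mulr_sumr -big_split/=.
apply: ler_sum => s _; rewrite -mulr_sumr.
rewrite [X in _ <= X + _]mulrCA [X in _ <= _ + X]mulrCA -mulrDr.
rewrite ler_wpM2l//.
have D x y : d x y <= \sum_x \sum_y d x y.
  rewrite (bigD1 x)//= (bigD1 y)//= -addrA lerDl addr_ge0// ?sumr_ge0// => x' _.
  by rewrite sumr_ge0.
case: (boolP (decodable p a z W e' C L b s)) => [dc|_].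
  rewrite mulr0 addr0 ler_wpM2l ?invr_ge0//; apply: ler_sum => i _.
  by rewrite decode_correct// ffunE code_wordE.
rewrite mulr1 -[leLHS]add0r lerD//.
  by rewrite mulr_ge0 ?invr_ge0// sumr_ge0.
rewrite ler_pdivrMl// -[n in leRHS]card_ord mulr_natl -sumr_const.
exact: ler_sum.
Qed.

(** Conditioning is weakened twice: for letter [i] only [g] and the codeword letter at [i] are kept,
    and then the position itself is forgotten. *)
Lemma cent_letterwise (A B : eqType) (f : T -> A) (g : T -> B) :
  cent Pn (ffmap f) (fun s => (ffmap g s, L (ffmap a s))) <=
  n%:R * cent (sjoint p a codeW) (fun w => f w.1) (fun w => (g w.1, w.2)).
Proof.
rewrite (cent_induced _ p1 code_word_upd)/=.
apply: (@le_trans _ _ (n%:R * cent (mixP Pn)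
   (fun v : 'I_n * {ffun 'I_n -> T} => f (v.2 v.1))
   (fun v : 'I_n * {ffun 'I_n -> T} => ((g (v.2 v.1), C (L (ffmap a v.2)) v.1), v.1)))).
  rewrite (cent_mix Pn0 Pn1 In0 (fun i s => f (s i))
     (fun i s => (g (s i), C (L (ffmap a s)) i))).
  rewrite card_ord mulVKf ?gt_eqF//.
  apply: le_trans (cent_fam Pn0 Pn1 (fun i s => f (s i)) _) _.
  apply: ler_sum => i _; apply: cent_mono_fun => // s t.
  rewrite !xpair_eqE => /andP[/eqP/ffunP E /eqP ->]; rewrite eqxx andbT.
  by have := E i; rewrite !ffunE => ->.
rewrite ler_wpM2l ?(ltW N0)//; apply: cent_mono_fun.
- exact: mixP_ge0.
- exact: mixP1.
- by move=> v w; rewrite !code_wordE !xpair_eqE => /andP[/andP[-> ->]].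
Qed.

Lemma code_equiv_ge :
  ent p (fun t => (a t, z t)) - n%:R^-1 * ln m.+1%:R -
  cent (sjoint p a codeW) (fun w => z w.1) (fun w => w.2) -
  cent (sjoint p a codeW) (fun w => (a w.1).1) (fun w => ((a w.1).2, (w.2, z w.1)))
  <= code_equiv p a z code_enc.
Proof.
rewrite /code_equiv.
pose l (s : {ffun 'I_n -> T}) := L (ffmap a s).
have s1 : cent Pn (ffmap (snd \o a)) (fun s => (l s, ffmap z s)) <=
          cent Pn (ffmap (snd \o a)) (fun s => (code_enc (ffmap a s), ffmap z s)).
  apply: cent_mono_fun => // s t; rewrite !xpair_eqE => /andP[/eqP E ->].
  by rewrite andbT /code_enc -/(l s) E.
(* The index is a function of X^n, so adjoining it does not refine the partition by (X^n, Z^n). *)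
have s2 : n%:R * ent p (fun t => (a t, z t)) =
   ent Pn (fun s => (ffmap (fst \o a) s, (ffmap (snd \o a) s, (l s, ffmap z s)))).
  have -> : n%:R = #|'I_n|%:R :> R by rewrite card_ord.
  rewrite -ent_prod//; apply: ent_eq => s t; rewrite !xpair_eqE.
  apply/eqP/and4P => [/ffunP E|[/eqP/ffunP E1 /eqP/ffunP E2 _ /eqP/ffunP E3]].
    have Ea : ffmap a s = ffmap a t.
      by apply/ffunP => i; have := E i; rewrite !ffunE => -[].
    split; rewrite /l ?Ea//; apply/eqP/ffunP => i; have := E i; rewrite !ffunE/=.
    - by move=> -[->].
    - by move=> -[->].
    - by move=> -[].
  apply/ffunP => i; have := E1 i; have := E2 i; have := E3 i; rewrite !ffunE/= => -> e2 e1.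
  by rewrite [a (s i)]surjective_pairing e1 e2 -surjective_pairing.
have s3 : ent Pn l <= ln m.+1%:R.
  by have := ent_le_ln Pn0 Pn1 l; rewrite card_ord.
(* A constant [g] leaves the conditioning on the index alone. *)
have s4 := cent_letterwise z (fun=> tt).
have s5 := cent_letterwise (fst \o a) (fun t => ((a t).2, z t)).
rewrite (cent_eq _ _ (ffmap z) l) in s4; last 2 first.
- move=> s t; rewrite xpair_eqE; congr (_ && _); rewrite -[RHS]andTb; congr (_ && _).
  by apply/eqP/ffunP => i; rewrite !ffunE.
- move=> s t; rewrite xpair_eqE -[RHS]andTb; congr (_ && _).
  by apply/eqP/ffunP => i; rewrite !ffunE.
rewrite [X in _ * X](cent_eq _ _ (fun w => z w.1) (fun w => w.2)) in s4; last 2 first.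
- by move=> s t; rewrite xpair_eqE eqxx.
- by move=> s t; rewrite xpair_eqE eqxx.
have E2 (s t : {ffun 'I_n -> T}) :
   ((ffmap (fun t => ((a t).2, z t)) s, l s) == (ffmap (fun t => ((a t).2, z t)) t, l t)) =
   ((ffmap (snd \o a) s, (l s, ffmap z s)) == (ffmap (snd \o a) t, (l t, ffmap z t))).
  rewrite !xpair_eqE [in RHS]andbC -andbA [in RHS]andbC; case: (l s == l t); last by rewrite !andbF.
  rewrite !andbT; apply/eqP/andP => [/ffunP E|[/eqP/ffunP E1 /eqP/ffunP E2]].
    by split; apply/eqP/ffunP => i; have := E i; rewrite !ffunE/= => -[].
  by apply/ffunP => i; have := E1 i; have := E2 i; rewrite !ffunE/= => -> ->.
rewrite (cent_eq _ _ (ffmap (fst \o a)) (fun s => (ffmap (snd \o a) s, (l s, ffmap z s)))) in s5; last 2 first.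
- by move=> s t; congr (_ && _); exact: E2.
- exact: E2.
have E3 (s t : T * U) : (((a s.1).2, z s.1, s.2) == ((a t.1).2, z t.1, t.2)) =
   (((a s.1).2, (s.2, z s.1)) == ((a t.1).2, (t.2, z t.1))).
  by rewrite !xpair_eqE -andbA; congr (_ && _); rewrite andbC.
rewrite [X in _ * X](cent_eq _ _ (fun w => (a w.1).1) (fun w => ((a w.1).2, (w.2, z w.1)))) in s5; last 2 first.
- by move=> s t; congr (_ && _); exact: E3.
- exact: E3.
have E4 : ent Pn (fun s => (l s, ffmap z s)) = ent Pn (fun s => (ffmap z s, l s)).
  by apply: ent_eq => s t; rewrite !xpair_eqE andbC.
rewrite ler_pdivlMl//; apply: le_trans s1.
have E5 (x y c1 c2 : R) : n%:R * (x - n%:R^-1 * y - c1 - c2) =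
    n%:R * x - y - n%:R * c1 - n%:R * c2.
  by field; rewrite gt_eqF.
rewrite E5 s2 {s2 E5}.
rewrite [X in X - _ - _ - _ <= _](_ : _ = cent Pn (ffmap (fst \o a))
   (fun s => (ffmap (snd \o a) s, (l s, ffmap z s))) +
   cent Pn (ffmap (snd \o a)) (fun s => (l s, ffmap z s)) +
   cent Pn (ffmap z) l + ent Pn l); last first.
  by rewrite /cent E4; ring.
exact: chain_bound.
Qed.

(** The type controls P(X = x) times the difference of the two channels; a single source point [t]
    weighs no more than P(X = a t). *)
Lemma code_joint_close (r : R) :
  (forall xu, `|type_of_code p a C L xu - mean_hit p a W xu| <= r) ->
  forall w, `|sjoint p a codeW w - J w| <= r.
Proof.
move=> close [t u].
pose pX x := \sum_t p t * (a t == x)%:R.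
have hitE (V : X -> U -> R) x v :
    \sum_w sjoint p a V w * hit a w (x, v) = pX x * V x v.
  transitivity (\sum_t' \sum_u' sjoint p a V (t', u') * hit a (t', u') (x, v)).
    by rewrite pair_bigA; apply: eq_bigr => -[].
  rewrite mulr_suml; apply: eq_bigr => t' _.
  rewrite (bigD1 v)//= big1 ?addr0 => [|v' ne]; last first.
    by rewrite /hit/= (negbTE ne) andbF mulr0.
  rewrite /hit/= eqxx andbT /sjoint/=.
  by case: eqP => [->|]; rewrite ?mulr1 ?mulr0 ?mul0r.
have typeE xu : type_of_code p a C L xu = \sum_w sjoint p a codeW w * hit a w xu.
  rewrite (sum_induced _ p1 code_word_upd) sum_mixP card_ord /= exchange_big/= mulr_sumr.
  apply: eq_bigr => s _; rewrite mulrCA; congr (_ * _); rewrite -mulr_sumr; congr (_ * _).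
  by apply: eq_bigr => i _; rewrite /hit /= code_wordE !ffunE.
have := close (a t, u).
rewrite typeE /mean_hit !hitE /sjoint/= -!mulrBr !normrM; apply: le_trans.
rewrite ler_wpM2r// ger0_norm//; apply: le_trans (ler_norm _).
rewrite /pX (bigD1 t)//= eqxx mulr1 lerDl sumr_ge0// => t' _.
by rewrite mulr_ge0.
Qed.

End CodeAnalysis.

Theorem achievability (d : Xr -> Xr -> R) (phi : U -> Zt -> Xr) :
  (forall x y, 0 <= d x y) -> forall e, 0 < e ->
  exists (n M : nat) (enc : {ffun 'I_n -> X} -> 'I_M.+1)
    (dec : 'I_M.+1 -> {ffun 'I_n -> Zt} -> {ffun 'I_n -> Xr}),
  [/\ (0 < n)%N, code_dist p a z d enc dec <= sdist p a z d W phi + e,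
      sequiv p a z W - e <= code_equiv p a z enc &
      ln M.+1%:R <= n%:R * (srate p a z W + e)].
Proof.
move=> d0 e e0; pose eta k : R := k.+1%:R^-1.
have eta0 k : 0 < eta k by rewrite invr_gt0.
pose D := \sum_x \sum_y d x y.
(* A sequence of codes with slack 1/(k+1): the induced joint laws converge to [J], so the induced
   distortions and entropies converge too, and a large k gives the code. *)
have /choice[V HV] k : exists V : X -> U -> R,
  [/\ channel V, forall w, `|sjoint p a V w - J w| <= eta k &
   exists (n M : nat) (enc : {ffun 'I_n -> X} -> 'I_M.+1)
    (dec : 'I_M.+1 -> {ffun 'I_n -> Zt} -> {ffun 'I_n -> Xr}),
  [/\ (0 < n)%N, code_dist p a z d enc dec <= sdist p a z d V phi + D * eta k,
     ent p (fun t => (a t, z t)) - (I1 + eta k) -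
     cent (sjoint p a V) (fun w => z w.1) (fun w => w.2) -
     cent (sjoint p a V) (fun w => (a w.1).1) (fun w => ((a w.1).2, (w.2, z w.1)))
       <= code_equiv p a z enc &
     ln M.+1%:R <= n%:R * (srate p a z W + eta k)]].
  have [n [m [M [C [L [b [e' [n0 Ht Hd Hm HM]]]]]]]] := coding_rates (eta0 k).
  exists (induced_channel p (code_word C L)); split.
  - exact: code_channel.
  - exact: code_joint_close.
  - exists n, M, (code_enc L b), (code_dec C b e' phi); split=> //.
    + apply: le_trans (code_dist_le C L b e' phi n0 d0) _.
      by rewrite lerD2l ler_wpM2l// sumr_ge0// => x _; rewrite sumr_ge0.
    + apply: le_trans (code_equiv_ge C L b n0).
      rewrite !lerD2r lerD2l lerN2 ler_pdivrMl ?ltr0n//.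
have eta_cvg : eta k @[k --> \oo] --> 0 by exact: cvg_harmonic.
have V0 k w : 0 <= sjoint p a (V k) w.
  by have [Vk _ _] := HV k; exact: sjoint_ge0.
have Jc w : sjoint p a (V k) w @[k --> \oo] --> J w.
  apply/cvgrPdist_le => r r0.
  have : \forall k \near \oo, eta k <= r by exact: (cvgr_le _ eta_cvg).
  by apply: filterS => k hk; rewrite distrC; apply: le_trans hk; have [_ ->] := HV k.
have cc (A B : finType) (f : T * U -> A) (g : T * U -> B) :
    cent (sjoint p a (V k)) f g @[k --> \oo] --> cent J f g by exact: cvg_cent.
have dc : sdist p a z d (V k) phi + D * eta k @[k --> \oo] --> sdist p a z d W phi.
  rewrite -[X in _ --> X]addr0 -[X in _ + X](mulr0 D); apply: cvgD.
    by apply: cvg_finsum => w; apply: cvgM => //; exact: cvg_cst.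
  by apply: cvgM => //; exact: cvg_cst.
have ec : ent p (fun t => (a t, z t)) - (I1 + eta k) -
     cent (sjoint p a (V k)) (fun w => z w.1) (fun w => w.2) -
     cent (sjoint p a (V k)) (fun w => (a w.1).1) (fun w => ((a w.1).2, (w.2, z w.1)))
     @[k --> \oo] --> sequiv p a z W.
  have I1c : I1 + eta k @[k --> \oo] --> I1.
    by rewrite -[X in _ --> X]addr0; apply: cvgD => //; exact: cvg_cst.
  rewrite (sequivE _ _ p0 Wk) -/I1.
  apply: cvgB; last exact: cc.
  apply: cvgB; last exact: cc.
  by apply: cvgB => //; exact: cvg_cst.
have n1 : \forall k \near \oo, sdist p a z d (V k) phi + D * eta k <= sdist p a z d W phi + e.
  by apply: (cvgr_le _ dc); rewrite ltrDl.
have n2 : \forall k \near \oo, sequiv p a z W - e <=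
    ent p (fun t => (a t, z t)) - (I1 + eta k) -
    cent (sjoint p a (V k)) (fun w => z w.1) (fun w => w.2) -
    cent (sjoint p a (V k)) (fun w => (a w.1).1) (fun w => ((a w.1).2, (w.2, z w.1))).
  by apply: (cvgr_ge _ ec); rewrite ltrBlDr ltrDl.
have n3 : \forall k \near \oo, eta k <= e by exact: (cvgr_le _ eta_cvg).
have [k [[k1 k2] k3]] := filter_ex (filterI (filterI n1 n2) n3).
have [_ _ [n [M [enc [dec [c1 c2 c3 c4]]]]]] := HV k.
exists n, M, enc, dec; split=> //.
- exact: le_trans c2 k1.
- exact: le_trans k2 c3.
- by apply: le_trans c4 _; rewrite ler_wpM2l// lerD2l.
Qed.

End Achievability.

(** * Back to bits, tuples and the operational definitions *)

From Stdlib Require Import Reals Lra.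
From mathcomp Require Import Rstruct Rstruct_topology ring lra.
Import Defs.
Import Order.TTheory GRing.Theory Num.Theory numFieldNormedType.Exports.
Local Open Scope ring_scope.

Local Notation R := Rdefinitions.R.
Local Notation ln := exp.ln.
Local Notation ln2 := (@exp.ln R 2%:R).

Lemma ln2_gt0 : 0 < ln2.
Proof. by rewrite ln_gt0// ltr1n. Qed.

Lemma ln2_le1 : ln2 <= 1.
Proof. by have := @le_ln1Dx R 1; rewrite -natr1; apply; exact: lt_trans (ltrN10 _) ltr01. Qed.

Lemma fsumE (T : finType) (f : T -> R) : fsum f = \sum_t f t.
Proof. by []. Qed.

Lemma probE (T : finType) (P : T -> R) (ev : T -> bool) : prob P ev = Pr P ev.
Proof. by rewrite /Pr [RHS]big_mkcond. Qed.

Lemma log2E (x : R) : log2 x = ln x / ln2.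
Proof. by rewrite /log2 RdivE !RlnE -INRE. Qed.

Section Entropy.
Context {T : finType} (P : T -> R).
Hypothesis P0 : forall t, 0 <= P t.

Lemma condHE (A B : eqType) (f : T -> A) (g : T -> B) :
  condH P f g = cent P f g / ln2.
Proof.
transitivity (- (\sum_t (P t * ln (Pr P (fun s => (f s, g s) == (f t, g t))) -
   P t * ln (Pr P (fun s => g s == g t))) / ln2)); last first.
  by rewrite -mulr_suml sumrB /cent /ent; ring.
rewrite /condH RoppE fsumE; congr (- _); apply: eq_bigr => t _.
rewrite log2E !probE RmultE RdivE -mulrBr -mulrA.
have := P0 t; rewrite le_eqVlt => /orP[/eqP <-|Pt]; first by rewrite !mul0r.
congr (_ * (_ / _)); rewrite ln_div ?posrE//.
- exact: (Pr_gt0 P0 (fun s => (f s, g s)) Pt).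
- exact: Pr_gt0.
Qed.

Hypothesis P1 : \sum_t P t = 1.

Lemma entHE (A : eqType) (f : T -> A) : entH P f = ent P f / ln2.
Proof.
rewrite /entH condHE; congr (_ / _); rewrite /cent.
have -> : ent P (fun=> tt) = 0.
  rewrite /ent big1 ?oppr0// => t _; rewrite /Pr (eq_bigl xpredT)// P1 ln1 mulr0//.
by rewrite subr0; apply: ent_eq => s t; rewrite xpair_eqE eqxx andbT.
Qed.

Lemma minfoE (A B : eqType) (f : T -> A) (g : T -> B) :
  minfo P f g = (ent P f - cent P f g) / ln2.
Proof. by rewrite /minfo RminusE entHE condHE -mulrBl. Qed.

End Entropy.

Section Tuples.
Context {n : nat} {T : finType}.

Definition ffun_of_tuple (s : n.-tuple T) : {ffun 'I_n -> T} := [ffun i => tnth s i].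
Definition tuple_of_ffun (f : {ffun 'I_n -> T}) : n.-tuple T := [tuple f i | i < n].

Lemma ffun_of_tupleK : cancel ffun_of_tuple tuple_of_ffun.
Proof. by move=> s; apply: eq_from_tnth => i; rewrite tnth_mktuple ffunE. Qed.

Lemma tuple_of_ffunK : cancel tuple_of_ffun ffun_of_tuple.
Proof. by move=> f; apply/ffunP => i; rewrite ffunE tnth_mktuple. Qed.

Lemma sum_tuple (F : n.-tuple T -> R) :
  \sum_s F s = \sum_f F (tuple_of_ffun f).
Proof.
rewrite (reindex tuple_of_ffun)//.
by exists ffun_of_tuple => x _; [exact: tuple_of_ffunK|exact: ffun_of_tupleK].
Qed.

Lemma map_tuple_of_ffun (S : finType) (g : T -> S) (f : {ffun 'I_n -> T}) :
  map_tuple g (tuple_of_ffun f) = [tuple g (f i) | i < n].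
Proof. by apply: eq_from_tnth => i; rewrite tnth_map !tnth_mktuple. Qed.

End Tuples.

Section Model.
Variables (K : nat) (A : 'I_K -> finType) (Kr Kh : {set 'I_K}) (Z : finType).
Variable p : row A * Z -> R.
Variable d : subrow A Kr -> subrow A Kr -> R.
Local Notation T := (row A * Z)%type.
Local Notation Xr := (subrow A Kr).
Local Notation Xh := (subrow A Kh).

Definition attr (t : T) : Xr * Xh := (proj Kr t.1, proj Kh t.1).
Definition side (t : T) : Z := t.2.
Definition uncurried (U : finType) (W : Xr -> Xh -> U -> R) (x : Xr * Xh) (u : U) : R :=
  W x.1 x.2 u.

Hypotheses (p0 : forall t, 0 <= p t) (p1 : \sum_t p t = 1).

Lemma is_kernelE (U : finType) (W : Xr -> Xh -> U -> R) :
  is_kernel W <-> channel (uncurried W).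
Proof.
split=> [H|[H0 H1] xr xh].
  split=> [[xr xh] u|[xr xh]]; first by apply/RleP; have [+ _] := H xr xh; apply.
  by have [_] := H xr xh.
split=> [u|]; first by apply/RleP; exact: (H0 (xr, xh) u).
exact: (H1 (xr, xh)).
Qed.

Section SingleLetter.
Context {U : finType} {W : Xr -> Xh -> U -> R}.
Hypothesis Wk : is_kernel W.
Let Wc : channel (uncurried W). Proof. exact/is_kernelE. Qed.

Lemma dist1E (phi : U -> Z -> Xr) :
  dist1 p d W phi = sdist p attr side d (uncurried W) phi.
Proof. by []. Qed.

Lemma equiv1E : equiv1 p W = sequiv p attr side (uncurried W) / ln2.
Proof. by rewrite /equiv1 (condHE (sjoint_ge0 attr p0 Wc)). Qed.

Lemma rate1E : rate1 p W = srate p attr side (uncurried W) / ln2.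
Proof.
rewrite /rate1 !(minfoE (sjoint_ge0 attr p0 Wc) (sum_sjoint attr p1 Wc)).
have e1 : ent (joint p W) (fun t => (proj Kh t.1.1, proj Kr t.1.1)) =
    ent (sjoint p attr (uncurried W)) (fun w => attr w.1).
  by apply: ent_eq => s t; rewrite !xpair_eqE andbC.
have e2 : cent (joint p W) (fun t => (proj Kh t.1.1, proj Kr t.1.1)) (fun t => t.2) =
    cent (sjoint p attr (uncurried W)) (fun w => attr w.1) (fun w => w.2).
  by apply: cent_eq => s t //; rewrite !xpair_eqE [X in X && _]andbC.
by rewrite RminusE -mulrBl e1 e2.
Qed.

End SingleLetter.

Section Codes.
Context {n M : nat}.
Variables (enc : n.-tuple Xr -> n.-tuple Xh -> 'I_M) (dec : 'I_M -> n.-tuple Z -> n.-tuple Xr).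

Definition fenc (x : {ffun 'I_n -> Xr * Xh}) : 'I_M :=
  enc [tuple (x i).1 | i < n] [tuple (x i).2 | i < n].
Definition fdec (j : 'I_M) (y : {ffun 'I_n -> Z}) : {ffun 'I_n -> Xr} :=
  ffun_of_tuple (dec j (tuple_of_ffun y)).

Lemma pnE (s : n.-tuple T) : pn p s = prodP p (ffun_of_tuple s).
Proof. by rewrite /prodP; apply: eq_bigr => i _; rewrite ffunE. Qed.

Lemma xrnE (f : {ffun 'I_n -> T}) :
  xrn Kr (tuple_of_ffun f) = [tuple (ffmap attr f i).1 | i < n].
Proof. by rewrite /xrn map_tuple_of_ffun; apply: eq_mktuple => i; rewrite ffunE. Qed.

Lemma xhnE (f : {ffun 'I_n -> T}) :
  xhn Kh (tuple_of_ffun f) = [tuple (ffmap attr f i).2 | i < n].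
Proof. by rewrite /xhn map_tuple_of_ffun; apply: eq_mktuple => i; rewrite ffunE. Qed.

Lemma znE (f : {ffun 'I_n -> T}) : zn (tuple_of_ffun f) = tuple_of_ffun (ffmap side f).
Proof. by rewrite /zn map_tuple_of_ffun; apply: eq_mktuple => i; rewrite ffunE. Qed.

Lemma fencE (f : {ffun 'I_n -> T}) :
  enc (xrn Kr (tuple_of_ffun f)) (xhn Kh (tuple_of_ffun f)) = fenc (ffmap attr f).
Proof. by rewrite xrnE xhnE. Qed.

Lemma distnE : distn p d enc dec = code_dist p attr side d fenc fdec.
Proof.
rewrite /distn fsumE sum_tuple; apply: eq_bigr => f _.
rewrite pnE tuple_of_ffunK fencE znE INRE; congr (_ * (_ * _)).
by apply: eq_bigr => i _; rewrite xrnE tnth_mktuple !ffunE.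
Qed.

Lemma equivnE : equivn p enc = code_equiv p attr side fenc / ln2.
Proof.
rewrite /equivn (condHE (P := @pn _ _ _ p n)); last first.
  by move=> s; rewrite pnE; exact: prodP_ge0.
rewrite INRE /code_equiv -mulrA; congr (_ * (_ / _)).
rewrite (cent_push (P2 := prodP p) (pi := tuple_of_ffun)); last first.
  by move=> F; rewrite sum_tuple; apply: eq_bigr => f _; rewrite pnE tuple_of_ffunK.
have zE (s t : {ffun 'I_n -> T}) : (zn (tuple_of_ffun s) == zn (tuple_of_ffun t)) =
    (ffmap side s == ffmap side t).
  by rewrite !znE (inj_eq (can_inj tuple_of_ffunK)).
have xE (s t : {ffun 'I_n -> T}) :
    (xhn Kh (tuple_of_ffun s) == xhn Kh (tuple_of_ffun t)) =
    (ffmap (snd \o attr) s == ffmap (snd \o attr) t).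
  apply/eqP/eqP => [|/ffunP E]; rewrite !xhnE.
    move=> E; apply/ffunP => i; have := congr1 (fun q => tnth q i) E.
    by rewrite !tnth_mktuple !ffunE.
  by apply: eq_mktuple => i; have := E i; rewrite !ffunE.
apply: cent_eq => s t; rewrite /= ?xpair_eqE !fencE zE// xE.
by [].
Qed.

End Codes.

Lemma fencK n M (enc : {ffun 'I_n -> Xr * Xh} -> 'I_M) :
  fenc (fun xr xh => enc [ffun i => (tnth xr i, tnth xh i)]) = enc.
Proof.
apply/funext => x; rewrite /fenc; congr enc; apply/ffunP => i.
by rewrite ffunE !tnth_mktuple; case: (x i).
Qed.

Lemma fdecK n M (dec : 'I_M -> {ffun 'I_n -> Z} -> {ffun 'I_n -> Xr}) :
  fdec (fun j y => tuple_of_ffun (dec j (ffun_of_tuple y))) = dec.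
Proof.
by apply/funext => j; apply/funext => y; rewrite /fdec !tuple_of_ffunK.
Qed.

Hypothesis d0 : forall x y, 0 <= d x y.

Theorem achievable_single_letter Rt D E :
  achievable Kh p d Rt D E <->
  exists (U : finType) (W : Xr -> Xh -> U -> R) (phi : U -> Z -> Xr),
    [/\ is_kernel W, dist1 p d W phi <= D, E <= equiv1 p W & rate1 p W <= Rt].
Proof.
have l0 := ln2_gt0; have l1 := ln2_le1.
split=> [H|[U [W [phi [Wk WD WE WR]]]] eps /RltP e0].
  have : single_letter p attr side d D (E * ln2) (Rt * ln2).
    (* A slack of [e] bits is [e * ln2 <= e] nats, so the same [e] serves in both units. *)
    apply: single_letter_closed => // e e0.
    have /H[n [n0 [M [enc [dec [/RleP HD [/RleP HE /RleP HM]]]]]]] : Rlt (IZR 0) e.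
      exact/RltP.
    have [t0 _] : exists t : T, True.
      case: (pickP (fun _ : T => true)) => [t _|E0]; first by exists t.
      by move: p1; rewrite big_pred0// => /eqP; rewrite eq_sym oner_eq0.
    have M0 : (0 < M)%nat.
      exact: leq_ltn_trans (leq0n _) (ltn_ord (enc [tuple proj Kr t0.1 | _ < n]
        [tuple proj Kh t0.1 | _ < n])).
    have [U [W [phi [Wc WD WE WR]]]] := converse attr side d p0 p1 (fenc enc) (fdec dec) n0 (side t0).
    exists U, W, phi; split=> //.
    - by rewrite WD -distnE.
    - apply: le_trans WE; move: HE; rewrite equivnE ler_pdivlMr//.
      apply: le_trans; rewrite RminusE mulrBl lerD2l lerN2.
      by rewrite ler_piMr// ltW.
    - apply: le_trans WR _; rewrite card_ord ler_pdivrMl ?ltr0n//.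
      have : ln (M%:R : R) <= n%:R * (Rt + e) * ln2.
        rewrite -[leRHS]expRK ler_ln ?posrE ?expR_gt0 ?ltr0n//.
        by move: HM; rewrite !INRE /Rpower RexpE RlnE.
      move/le_trans; apply; rewrite -mulrA ler_wpM2l// mulrDl lerD2l ler_piMr ?(ltW e0)//.
  move=> [U [W [phi [Wc WD WE WR]]]].
  pose V xr xh u := W (xr, xh) u.
  have VW : uncurried V = W by apply/funext => -[xr xh].
  have Vk : is_kernel V by apply/is_kernelE; rewrite VW.
  exists U, V, phi; split=> //.
  - by rewrite (equiv1E Vk) VW ler_pdivlMr.
  - by rewrite (rate1E Vk) VW ler_pdivrMr.
have Wc : channel (uncurried W) by exact/is_kernelE.
(* A slack of [eps * ln2] nats is [eps] bits; for the distortion, which has no unit,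
   [eps * ln2 <= eps] suffices. *)
have [n [M [enc [dec [n0 cD cE cM]]]]] := achievability attr side p0 p1 Wc phi d0 (mulr_gt0 e0 l0).
have el : eps * ln2 <= eps by rewrite ler_piMr// ltW.
exists n; split; first exact: n0.
exists M.+1, (fun xr xh => enc [ffun i => (tnth xr i, tnth xh i)]).
exists (fun j y => tuple_of_ffun (dec j (ffun_of_tuple y))).
split; [|split]; apply/RleP.
- rewrite distnE fencK fdecK (le_trans cD)// RplusE lerD//.
- rewrite equivnE fencK ler_pdivlMr// (le_trans _ cE)//.
  by rewrite RminusE mulrBl lerD2r -ler_pdivlMr// -(equiv1E Wk).
- rewrite /Rpower RexpE RlnE !INRE -[leLHS]lnK ?posrE ?ltr0n// ler_expR (le_trans cM)//.
  rewrite RmultE -mulrA ler_wpM2l// mulrDl lerD2r -ler_pdivrMr// -(rate1E Wk)//.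
Qed.

End Model.

(** * The rate-distortion-equivocation region *)

Section Region.
Variables (K : nat) (A : 'I_K -> finType) (Kr Kh : {set 'I_K}) (Z : finType).
Variable p : row A * Z -> R.
Variable d : subrow A Kr -> subrow A Kr -> R.
Local Notation T := (row A * Z)%type.
Local Notation Xr := (subrow A Kr).
Local Notation Xh := (subrow A Kh).
Local Notation attr := (attr (A := A) Kr Kh (Z := Z)).
Local Notation side := (side (A := A) (Z := Z)).
Hypotheses (p0 : forall t, 0 <= p t) (p1 : \sum_t p t = 1).
Hypothesis d0 : forall x y, 0 <= d x y.

Definition reveal (xr : Xr) (xh : Xh) (u : Xr) : R := (u == xr)%:R.

Lemma reveal_kernel : is_kernel reveal.
Proof.
apply/is_kernelE; split=> [x u|x]; rewrite /uncurried /reveal ?ler0n//.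
by rewrite (bigD1 x.1)//= eqxx big1 ?addr0// => u /negbTE ->.
Qed.

(** A minimizer of [d u] in place of [u] itself, because [d] is an arbitrary nonnegative
    function. *)
Definition best_guess (u : Xr) (_ : Z) : Xr := [arg min_(x < u) d u x]%O.

Lemma sum_reveal (F : T * Xr -> R) :
  \sum_w sjoint p attr (uncurried reveal) w * F w = \sum_t p t * F (t, proj Kr t.1).
Proof.
transitivity (\sum_t \sum_u sjoint p attr (uncurried reveal) (t, u) * F (t, u)).
  by rewrite pair_bigA; apply: eq_bigr => -[].
apply: eq_bigr => t _; rewrite (bigD1 (proj Kr t.1))//= big1 ?addr0 => [|u ne].
  by rewrite /sjoint /uncurried /reveal/= eqxx mulr1.
by rewrite /sjoint /uncurried /reveal/= (negbTE ne) mulr0 mul0r.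
Qed.

Lemma equiv1_reveal : equiv1 p reveal = H_h_rZ Kr Kh p.
Proof.
rewrite (equiv1E p0 reveal_kernel) /H_h_rZ (condHE p0) /sequiv.
by rewrite (cent_push _ _ sum_reveal).
Qed.

Lemma dist1_reveal (U : finType) (V : Xr -> Xh -> U -> R) (psi : U -> Z -> Xr) :
  is_kernel V -> dist1 p d reveal best_guess <= dist1 p d V psi.
Proof.
move=> /is_kernelE Vk; rewrite !dist1E {1}/sdist.
rewrite (sum_reveal (fun w => d (attr w.1).1 (best_guess w.2 (side w.1)))).
rewrite -(sum_sjoint_fst p attr Vk (fun t => d (attr t).1 (best_guess (proj Kr t.1) (side t)))).
apply: ler_sum => w _; rewrite ler_wpM2l ?sjoint_ge0//.
by rewrite /best_guess; case: arg_minP => // x _; apply.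
Qed.

Lemma dist1_ge0 (U : finType) (V : Xr -> Xh -> U -> R) (psi : U -> Z -> Xr) :
  is_kernel V -> 0 <= dist1 p d V psi.
Proof.
move=> /is_kernelE Vk; rewrite dist1E; apply: sumr_ge0 => w _.
by rewrite mulr_ge0 ?sjoint_ge0.
Qed.

Lemma H_h_rZ_le : H_h_rZ Kr Kh p <= H_h_Z Kh p.
Proof.
rewrite /H_h_rZ /H_h_Z !(condHE p0) ler_pM2r ?invr_gt0 ?ln2_gt0//.
exact: (cent_mono p0 p1 (fun s => proj Kh s.1) (fun s => proj Kr s.1) (fun s => s.2)).
Qed.

Lemma equiv1_le (U : finType) (V : Xr -> Xh -> U -> R) :
  is_kernel V -> equiv1 p V <= H_h_Z Kh p.
Proof.
move=> Vk; have Vc : channel (uncurried V) by exact/is_kernelE.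
rewrite (equiv1E p0 Vk) /H_h_Z (condHE p0) ler_pM2r ?invr_gt0 ?ln2_gt0//.
have -> : cent p (fun s => proj Kh s.1) (fun s => s.2) =
    cent (sjoint p attr (uncurried V)) (fun w => proj Kh w.1.1) (fun w => w.1.2).
  by apply: (cent_push (pi := fst)) => F; rewrite sum_sjoint_fst.
exact: (cent_mono (sjoint_ge0 attr p0 Vc) (sum_sjoint attr p1 Vc)
  (fun w => proj Kh w.1.1) (fun w => w.2) (fun w => w.1.2)).
Qed.

Lemma rate1_ge0 (U : finType) (V : Xr -> Xh -> U -> R) : is_kernel V -> 0 <= rate1 p V.
Proof.
move=> Vk; rewrite (rate1E p0 p1 Vk) divr_ge0 ?(ltW ln2_gt0)//.
by apply: srate_ge0 => //; exact/is_kernelE.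
Qed.

Lemma rate1_le (U : finType) (V : Xr -> Xh -> U -> R) :
  is_kernel V -> rate1 p V <= cent p attr side / ln2.
Proof.
move=> Vk; have Vc : channel (uncurried V) by exact/is_kernelE.
rewrite (rate1E p0 p1 Vk) ler_pM2r ?invr_gt0 ?ln2_gt0// (srateE _ _ p0 Vc).
rewrite lerBlDr lerDl; 
exact: (cent_ge0 (sjoint_ge0 attr p0 Vc) (fun w => attr w.1) (fun w => (w.2, side w.1))).
Qed.

End Region.

Local Open Scope R_scope.

(** * Suprema and infima over test channels *)

Section Sets.
Variables (K : nat) (A : 'I_K -> finType) (Kr Kh : {set 'I_K}) (Z : finType).
Variables (p : row A * Z -> R) (hp : is_pmf p).
Variables (d : subrow A Kr -> subrow A Kr -> R) (hd : forall a b, 0 <= d a b).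

Let p0 : forall t, is_true (0 <= p t)%O.
Proof. by move=> t; apply/RleP; case: hp. Qed.
Let p1 : (\sum_t p t = 1)%R. Proof. by case: hp. Qed.
Let d0 : forall x y, is_true (0 <= d x y)%O. Proof. by move=> x y; apply/RleP. Qed.

Lemma achievable_RateSet Rt D E :
  achievable Kh p d Rt D E <-> exists2 r, RateSet Kh p d D E r & r <= Rt.
Proof.
have S := @achievable_single_letter _ _ _ Kh _ _ _ p0 p1 d0 Rt D E.
split=> [/S|].
  move=> [U [W [phi [Wk /RleP WD /RleP WE /RleP WR]]]].
  by exists (rate1 p W) => //; exists U, W; split=> //; split=> //; exists phi.
move=> [_ [U [W [[Wk [phi [WD WE]]] ->]]] WR].
by apply/S; exists U, W, phi; split=> //; apply/RleP.
Qed.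

Lemma inRDE_RateSet D E : inRDE Kh p d D E <-> exists r, RateSet Kh p d D E r.
Proof.
split=> [[Rt /achievable_RateSet[r rS _]]|[r rS]]; first by exists r.
by exists r; apply/achievable_RateSet; exists r => //; exact: Rle_refl.
Qed.

Lemma GammaSet_inRDE D e : GammaSet Kh p d D e -> inRDE Kh p d D e.
Proof.
move=> [U [W [[E [_ [_ [Wk [phi [WD WE]]]]]] ->]]]; apply/inRDE_RateSet.
by exists (rate1 p W), U, W; split=> //; split=> //; exists phi; split=> //; exact: Rle_refl.
Qed.

(* When [equiv1 W] falls below [H(X_h | X_r, Z)], disclosing [X_r] itself does
   better, with the least possible distortion. *)
Lemma inRDE_GammaSet D E : inRDE Kh p d D E -> exists2 e, GammaSet Kh p d D e & E <= e.
Proof.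
move=> /inRDE_RateSet[_ [U [W [[Wk [phi [WD WE]]] _]]]].
have [h|h] := Rle_lt_dec (H_h_rZ Kr Kh p) (equiv1 p W).
  exists (equiv1 p W) => //; exists U, W; split=> //.
  exists (H_h_rZ Kr Kh p); split; first exact: Rle_refl.
  split; first exact/RleP/H_h_rZ_le.
  by split=> //; exists phi.
have Rk := @reveal_kernel K A Kr Kh.
exists (H_h_rZ Kr Kh p); last by Lra.lra.
exists (subrow A Kr), (reveal (Kh := Kh)); rewrite equiv1_reveal//; split=> //.
exists (H_h_rZ Kr Kh p); split; first exact: Rle_refl.
split; first exact/RleP/H_h_rZ_le.
split=> //; exists (best_guess d); rewrite equiv1_reveal//.
split; last exact: Rle_refl.
by apply: Rle_trans WD; apply/RleP/dist1_reveal.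
Qed.

Lemma GammaSet_le D e : GammaSet Kh p d D e -> e <= H_h_Z Kh p.
Proof. by move=> [U [W [[E [_ [_ [Wk _]]]] ->]]]; exact/RleP/equiv1_le. Qed.

(** The slack of the definition can be split in two halves. Hence supremum and infimum need only be
    approached by test channels. *)
Lemma achievable_closed Rt D E :
  (forall eps, 0 < eps -> achievable Kh p d (Rt + eps) D (E - eps)) ->
  achievable Kh p d Rt D E.
Proof.
move=> H eps e0; have e2 : 0 < eps / 2 by Lra.lra.
have [n [n0 [M [enc [dec [h1 [h2 h3]]]]]]] := H _ e2 _ e2.
exists n; split=> //; exists M, enc, dec; split; [|split].
- by Lra.lra.
- by Lra.lra.
- by move: h3; rewrite (_ : Rt + eps / 2 + eps / 2 = Rt + eps)//; Lra.lra.
Qed.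

End Sets.

From mathcomp Require Import all_boot.
From Stdlib Require Import Reals.
Local Open Scope R_scope.

Theorem theorem2 (K : nat) (A : 'I_K -> finType) (Kr Kh : {set 'I_K})
  (hcover : Kr :|: Kh = setT) (Z : finType)
  (p : row A * Z -> R) (hp : is_pmf p)
  (d : subrow A Kr -> subrow A Kr -> R) (hd : forall a b, 0 <= d a b) :
  (* Gamma(D) = sup over P(D) of H(X_h | U, Z) *)
  (forall D g,
     is_lub (fun E => inRDE Kh p d D E) g <-> is_lub (GammaSet Kh p d D) g) /\
  (* R(D,E) = inf over P(D,E) of I(X_h X_r; U) - I(Z; U) *)
  (forall D E r,
     is_glb (fun Rt => achievable Kh p d Rt D E) r <->
     is_glb (RateSet Kh p d D E) r) /\
  (* R_{D-E} = {(D,E) : D >= 0, 0 <= E <= Gamma(D)} *)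
  (forall D E, 0 <= E ->
     (inRDE Kh p d D E <->
      0 <= D /\ 0 <= E /\
      exists g, is_lub (GammaSet Kh p d D) g /\ E <= g)) /\
  (* R = {(R,D,E) : D >= 0, 0 <= E <= Gamma(D), R >= R(D,E)} *)
  (forall Rt D E, 0 <= E ->
     (achievable Kh p d Rt D E <->
      0 <= D /\ 0 <= E /\
      (exists g, is_lub (GammaSet Kh p d D) g /\ E <= g) /\
      (exists r, is_glb (RateSet Kh p d D E) r /\ r <= Rt))).
Proof.
have p0 : forall t, is_true (0 <= p t)%O by move=> t; apply/RleP; case: hp.
have p1 : (\sum_t p t = 1)%R by case: hp.
have d0 : forall x y, is_true (0 <= d x y)%O by move=> x y; apply/RleP.
have inG := inRDE_GammaSet hp hd.
have Gin := GammaSet_inRDE hp hd.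
have D_ge0 D E : inRDE Kh p d D E -> 0 <= D.
  move=> /(inRDE_RateSet Kh hp hd)[_ [U [W [[Wk [phi [WD _]]] _]]]].
  by apply: Rle_trans WD; apply/RleP/dist1_ge0.
(* The supremum exists because [GammaSet] is bounded by H(X_h | Z). *)
have gamma_ex D E : inRDE Kh p d D E -> exists g, is_lub (GammaSet Kh p d D) g /\ E <= g.
  move=> /inG[e eG Ee].
  have [|//|g gG] := completeness (GammaSet Kh p d D); last 1 first.
  - by exists g; split=> //; apply: Rle_trans Ee _; exact: gG.1.
  - by exists (H_h_Z Kh p) => e' /(GammaSet_le hp).
  - by exists e.
split; [|split; [|split]].
- move=> D g; split=> -[ub lb]; split.
  + by move=> e /Gin; exact: ub.
  + by move=> b bub; apply: lb => E /inG[e eG Ee]; apply: Rle_trans Ee _; exact: bub.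
  + by move=> E /inG[e eG Ee]; apply: Rle_trans Ee _; exact: ub.
  + by move=> b bub; apply: lb => e /Gin; exact: bub.
- move=> D E r; split=> -[lb gl]; split.
  + move=> q qS; apply: lb; apply/(achievable_RateSet Kh hp hd).
    by exists q => //; exact: Rle_refl.
  + move=> b bl; apply: gl => Rt /(achievable_RateSet Kh hp hd)[q qS qR].
    by apply: Rle_trans qR; exact: bl.
  + move=> Rt /(achievable_RateSet Kh hp hd)[q qS qR].
    by apply: Rle_trans qR; exact: lb.
  + move=> b bl; apply: gl => q qS; apply: bl; apply/(achievable_RateSet Kh hp hd).
    by exists q => //; exact: Rle_refl.
- move=> D E E0; split=> [H|[_ [_ [g [[ub lb] Eg]]]]].
    by split; [exact: D_ge0 H|split=> //; exact: gamma_ex].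
  (* H(X | Z) in bits bounds the rate of every test channel, so this one rate serves for all
     [eps]. *)
  exists (cent p (attr Kr Kh (Z := Z)) (side (Z := Z)) / ln2)%R.
  apply: achievable_closed => eps e0; apply/(achievable_RateSet Kh hp hd).
  have [e eG eE] : exists2 e, GammaSet Kh p d D e & E - eps <= e.
    apply: contrapT => H; have : g <= E - eps; last by Lra.lra.
    apply: lb => e eG; apply: Rnot_lt_le => he; apply: H.
    by exists e => //; Lra.lra.
  have [U [W [[E' [_ [_ [Wk [phi [WD WE]]]]]] eW]]] := eG.
  exists (rate1 p W).
    by exists U, W; split=> //; split=> //; exists phi; rewrite -eW.
  have /RleP := rate1_le p0 p1 Wk; move=> h; apply: Rle_trans h _.
  by rewrite -[X in X <= _]Rplus_0_r; apply: Rplus_le_compat_l; exact: Rlt_le.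
- move=> Rt D E E0; split=> [H|[_ [_ [_ [r [[lb gl] rR]]]]]].
    have HE : inRDE Kh p d D E by exists Rt.
    split; first exact: D_ge0 HE.
    split=> //; split; first exact: gamma_ex.
    have /(achievable_RateSet Kh hp hd)[q qS qR] := H.
    (* The infimum is obtained as minus the supremum of the reflected set, which is bounded above by
       0 since rates are nonnegative. *)
    have [|//|m [mub mlb]] := completeness (fun x => RateSet Kh p d D E (- x)); last 1 first.
    + exists (- m); split; last first.
        have : - q <= m by apply: mub; rewrite Ropp_involutive.
        by Lra.lra.
      split=> [x xS|b bl].
        have : - x <= m by apply: mub; rewrite Ropp_involutive.
        by Lra.lra.
      have : m <= - b; last by Lra.lra.
      by apply: mlb => x /bl; Lra.lra.
    + exists 0 => x [U [W [[Wk _] xW]]].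
      have h : 0 <= rate1 p W by exact/RleP/rate1_ge0.
      by move: h; rewrite -xW; Lra.lra.
    + by exists (- q); rewrite Ropp_involutive.
  apply: achievable_closed => eps e0; apply/(achievable_RateSet Kh hp hd).
  have [q qS qr] : exists2 q, RateSet Kh p d D E q & q <= r + eps.
    apply: contrapT => H; have : r + eps <= r; last by Lra.lra.
    apply: gl => q qS; apply: Rnot_lt_le => hq; apply: H.
    by exists q => //; Lra.lra.
  exists q; last by Lra.lra.
  have [U [W [[Wk [phi [WD WE]]] ->]]] := qS.
  exists U, W; split=> //; split=> //; exists phi; split=> //; Lra.lra.
Qed.
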